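(* For all fixed integers $u,v\ge1$ and any fixed even integer $k\ge 2$, $\chi\left(\left(\mathfrak{X}^{u,v}\right)^k\right)$ is asymptotically (when $n\to+\infty$) a $\left(\tfrac12\,\mathcal{U}(2\mathbb{T})+\tfrac12\mu_{\mathbb{C}\text{-}arc(2)}\right)$-distributed random variable, and $\chi\left(\left(\mathfrak{X}^{0,v}\right)^k\right)$ admits $\tfrac12\delta_2+\tfrac12\mu_{arc(-2,2)}$ as asymptotic $*$-distribution (when $n\to+\infty$).
   Context: For $n\ge 2$, $\mathcal{A}_n=\bigoplus_{i,j\in\mathbb{Z}_n}\mathbb{C}e_{(i,j)}\oplus\mathcal{M}_n(\mathbb{C})$ is the multi-matrix $*$-algebra (usual multiplication and involution) underlying the Sekine finite quantum group $\mathbb{KP}_n$, with basis the minimal projections $e_{(i,j)}$, $i,j\in\mathbb{Z}_n$, and the matrix units $E_{i,j}$, $1\le i,j\le n$ of $\mathcal{M}_n(\mathbb{C})$ (indices of $E$ read modulo $n$); $\eta=e^{2\imath\pi/n}$. Its Haar state is \[h_n\left(\sum_{i,j\in\mathbb{Z}_n}x_{(i,j)}e_{(i,j)}+\sum_{i,j=1}^nX_{i,j}E_{i,j}\right)=\frac1{2n^2}\left(\sum_{i,j\in\mathbb{Z}_n}x_{(i,j)}+n\sum_{i=1}^nX_{i,i}\right).\] For $u\in\{0,\dots,n-1\}$ and $v\in\{1,\dots,\lfloor\frac{n-1}2\rfloor\}$, $\mathfrak{X}^{u,v}\in\mathcal{M}_2(\mathcal{A}_n)$ is the two-dimensional irreducible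 representation with entries \[\mathfrak{X}^{u,v}_{11}=\sum_{i,j\in\mathbb{Z}_n}\eta^{iu+jv}e_{(i,j)},\ \ \mathfrak{X}^{u,v}_{12}=\sum_{i=1}^n\eta^{-iv}E_{i,i+u},\ \ \mathfrak{X}^{u,v}_{21}=\sum_{i=1}^n\eta^{iv}E_{i,i+u},\ \ \mathfrak{X}^{u,v}_{22}=\sum_{i,j\in\mathbb{Z}_n}\eta^{iu-jv}e_{(i,j)}.\] Powers are taken in $\mathcal{M}_2(\mathcal{A}_n)$ and $\chi(M)=\sum_iM_{ii}\in\mathcal{A}_n$. For fixed $u,v$ the representation exists for all sufficiently large $n$. Asymptotic distribution is convergence in $*$-moments: a sequence $x_n\in\mathcal{A}_n$ has asymptotic $*$-distribution $\mu$ (a probability measure on $\mathbb{C}$) if for every $m$ and $\varepsilon_1,\dots,\varepsilon_m\in\{\emptyset,*\}$, $h_n(x_n^{\varepsilon_1}\cdots x_n^{\varepsilon_m})\to\int z^{\varepsilon_1}\cdots z^{\varepsilon_m}\,d\mu(z)$ as $n\to\infty$, where $z^\emptyset=z$ and $z^*=\bar z$. $\delta_x$ is the Dirac mass at $x$. $\mathcal{U}(2\mathbb{T})$ is the uniform distribution on the circle $\{z\in\mathbb{C}:|z|=2\}$. $\mu_{arc(-2,2)}$ is the arcsine distribution on $(-2,2)$, with density $\frac1{\pi\sqrt{4-x^2}}$. $\mu_{\mathbb{C}\text{-}arc(\alpha)}$ is the law on $\mathbb{C}$ of $re^{\imath\theta}$ where $(r,\theta)\in(0,\alpha)\times(0,2\pi)$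 has density $\frac1{\pi^2\sqrt{\alpha^2-r^2}}$ with respect to $dr\,d\theta$. *)

(* Defs.v *)
From HB Require Import structures.
From mathcomp Require Import all_boot all_order all_algebra.
From mathcomp Require Import all_classical all_reals all_analysis.
From mathcomp Require Import measurable_realfun complex.

Set Implicit Arguments.
Unset Strict Implicit.
Unset Printing Implicit Defensive.

Import Order.TTheory GRing.Theory Num.Theory.
Import numFieldNormedType.Exports.

Local Open Scope classical_set_scope.
Local Open Scope ring_scope.
Local Open Scope complex_scope.

(* The Borel sigma-algebra of the complex plane, transported from the product
   sigma-algebra of R * R along (x, y) |-> x + i y. *)
Section complex_measurable.
Context {R : realType}.

Definition complex_of_pair (p : R * R) : R[i] := p.1 +i* p.2.

Definition cmeasurable : set (set R[i]) :=
  [set A | measurable (complex_of_pair @^-1` A)].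

Let cmeasurable0 : cmeasurable set0.
Proof. by rewrite /cmeasurable /= preimage_set0. Qed.

Let cmeasurableC A : cmeasurable A -> cmeasurable (~` A).
Proof. by rewrite /cmeasurable /= preimage_setC; exact: measurableC. Qed.

Let cmeasurable_bigcup (F : (set R[i])^nat) :
  (forall i, cmeasurable (F i)) -> cmeasurable (\bigcup_i F i).
Proof.
by move=> mF; rewrite /cmeasurable /= preimage_bigcup; exact: bigcupT_measurable.
Qed.

HB.instance Definition _ := isPointed.Build R[i] 0.
HB.instance Definition _ := @isMeasurable.Build default_measure_display R[i]
  cmeasurable cmeasurable0 cmeasurableC cmeasurable_bigcup.

Lemma measurable_fun_complex d (T : measurableType d) (f g : T -> R) :
  measurable_fun setT f -> measurable_fun setT g ->
  measurable_fun setT (fun t => f t +i* g t).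
Proof.
move=> mf mg _ A mA; rewrite setTI.
have := measurable_fun_pair mf mg measurableT mA.
by rewrite setTI.
Qed.

End complex_measurable.

Section measures.
Context d d' (T : measurableType d) (T' : measurableType d') (R : realType).
Variable mu : {measure set T -> \bar R}.
Local Open Scope ereal_scope.

Definition density_measure (f : {mfun T >-> R}) (f0 : forall x, (0 <= f x)%R)
  (A : set T) : \bar R := \int[mu]_(x in A) (f x)%:E.

Section density.
Variables (f : {mfun T >-> R}) (f0 : forall x, (0 <= f x)%R).

Let density0 : density_measure f0 set0 = 0.
Proof. by rewrite /density_measure integral_set0. Qed.

Let density_ge0 A : 0 <= density_measure f0 A.
Proof. by apply: integral_ge0 => x _; rewrite lee_fin. Qed.

Let density_sigma_additive : semi_sigma_additive (density_measure f0).
Proof.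
apply: semi_sigma_additive_nng_induced => [|x]; last by rewrite lee_fin.
by apply/measurable_EFinP.
Qed.

HB.instance Definition _ := isMeasure.Build _ _ _ (density_measure f0)
  density0 density_ge0 density_sigma_additive.

End density.

Definition law (g : {mfun T >-> T'}) (A : set T') : \bar R :=
  pushforward mu g A.

Section law.
Variable g : {mfun T >-> T'}.

Let law0 : law g set0 = 0.
Proof. exact: measure0. Qed.

Let law_ge0 A : 0 <= law g A.
Proof. exact: measure_ge0. Qed.

Let law_sigma_additive : semi_sigma_additive (law g).
Proof. exact: measure_semi_sigma_additive. Qed.

HB.instance Definition _ := isMeasure.Build _ _ _ (law g)
  law0 law_ge0 law_sigma_additive.

End law.
End measures.

Definition half_mixture d (T : measurableType d) (R : realType)
    (mu nu : {measure set T -> \bar R}) : {measure set T -> \bar R} :=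
  measure_add (mscale (2^-1)%:nng mu) (mscale (2^-1)%:nng nu).

Section distributions.
Context {R : realType}.
Notation mu := (@lebesgue_measure R).

Definition expi (t : R) : R[i] := cos t +i* sin t.

Definition polar (p : measurableTypeR R * measurableTypeR R) : R[i] :=
  p.1%:C * expi p.2.

Let measurable_polar : measurable_fun setT polar.
Proof.
rewrite (_ : polar = fun p => (p.1 * cos p.2) +i* (p.1 * sin p.2)); last first.
  by apply/funext => -[r t]; apply/eqP; rewrite eq_complex /= !mul0r subr0 addr0 !eqxx.
have mcos : measurable_fun setT (@cos R).
  by apply: continuous_measurable_fun; exact: continuous_cos.
have msin : measurable_fun setT (@sin R).
  by apply: continuous_measurable_fun; exact: continuous_sin.
apply: measurable_fun_complex; apply: measurable_funM.
- exact: measurable_fst.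
- by apply: (measurableT_comp mcos); exact: measurable_snd.
- exact: measurable_fst.
- by apply: (measurableT_comp msin); exact: measurable_snd.
Qed.

HB.instance Definition _ := isMeasurableFun.Build _ _ _ _ polar measurable_polar.

Definition circle_map (r : R) (t : measurableTypeR R) : R[i] := polar (r, t).

Let measurable_circle_map r : measurable_fun setT (circle_map r).
Proof.
exact: (measurableT_comp measurable_polar (pair1_measurable _)).
Qed.

HB.instance Definition _ r :=
  isMeasurableFun.Build _ _ _ _ (circle_map r) (measurable_circle_map r).

Definition real_map (x : measurableTypeR R) : R[i] := (x : R)%:C.

Let measurable_real_map : measurable_fun setT real_map.
Proof.
by apply: measurable_fun_complex; [exact: measurable_id|exact: measurable_cst].
Qed.

HB.instance Definition _ :=
  isMeasurableFun.Build _ _ _ _ real_map measurable_real_map.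

Definition arcsine_pdf (a : R) (x : measurableTypeR R) : R :=
  \1_(`]- a, a[%classic) x * (pi * Num.sqrt (a ^+ 2 - x ^+ 2))^-1.

Definition polar_arcsine_pdf (a : R)
    (p : measurableTypeR R * measurableTypeR R) : R :=
  \1_(`]0, a[%classic `*` `]0, 2 * pi[%classic) p *
  (pi ^+ 2 * Num.sqrt (a ^+ 2 - p.1 ^+ 2))^-1.

Lemma arcsine_pdf_ge0 a x : 0 <= arcsine_pdf a x.
Proof.
by rewrite /arcsine_pdf indicE mulr_ge0// invr_ge0 mulr_ge0 ?pi_ge0 ?sqrtr_ge0.
Qed.

Lemma polar_arcsine_pdf_ge0 a p : 0 <= polar_arcsine_pdf a p.
Proof.
by rewrite /polar_arcsine_pdf indicE mulr_ge0// invr_ge0 mulr_ge0 ?sqr_ge0 ?sqrtr_ge0.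
Qed.

Let measurable_inv_sqrt (c a : R) : 0 <= c ->
  measurable_fun setT (fun x : R => (c * Num.sqrt (a ^+ 2 - x ^+ 2))^-1).
Proof.
move=> c0.
rewrite (_ : (fun _ => _) =
    (@powR R ^~ (-1)) \o (fun x => c * Num.sqrt (a ^+ 2 - x ^+ 2))); last first.
  by apply/funext => x /=; rewrite powR_inv1// mulr_ge0// sqrtr_ge0.
apply: measurableT_comp; first exact: measurable_powR.
apply: measurable_funM => //.
apply: (measurableT_comp (f := @Num.sqrt R)).
  by apply: continuous_measurable_fun; exact: sqrt_continuous.
exact: measurable_funB.
Qed.

Let measurable_arcsine_pdf a : measurable_fun setT (arcsine_pdf a).
Proof.
apply: measurable_funM; first exact: measurable_indic.
by apply: measurable_inv_sqrt; exact: pi_ge0.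
Qed.

Let measurable_polar_arcsine_pdf a : measurable_fun setT (polar_arcsine_pdf a).
Proof.
apply: measurable_funM; first by apply: measurable_indic; exact: measurableX.
apply: (measurableT_comp (measurable_inv_sqrt a _)); first exact: sqr_ge0.
exact: measurable_fst.
Qed.

HB.instance Definition _ a :=
  isMeasurableFun.Build _ _ _ _ (arcsine_pdf a) (measurable_arcsine_pdf a).

HB.instance Definition _ a := isMeasurableFun.Build _ _ _ _
  (polar_arcsine_pdf a) (measurable_polar_arcsine_pdf a).

Let twopi_gt0 : 0 < 2 * pi :> R.
Proof. by rewrite mulr_gt0 ?pi_gt0. Qed.

Definition uniform_circle (r : R) : {measure set R[i] -> \bar R} :=
  law (uniform_prob twopi_gt0) (circle_map r).

Definition arcsine (a : R) : {measure set R[i] -> \bar R} :=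
  law (density_measure mu (arcsine_pdf_ge0 a)) real_map.

Definition complex_arcsine (a : R) : {measure set R[i] -> \bar R} :=
  law (density_measure (mu \x mu)%E (polar_arcsine_pdf_ge0 a)) polar.

End distributions.

Section sekine.
Context {R : realType}.
Notation C := R[i].

(* The multi-matrix algebra of the Sekine quantum group, as a product of
   rings.  Both Z_n and the index set {1, ..., n} read modulo n are represented
   by 'I_n.  Only n >= 2 is meaningful; as every statement is about n tending
   to infinity, the degenerate values n = 0, 1 are harmless. *)
Definition sekine (n : nat) : Type := ({ffun 'I_n * 'I_n -> C} * 'M[C]_n)%type.

Definition star n (x : sekine n) : sekine n :=
  ([ffun p => ((x.1 p)^*)%R], map_mx Num.conj x.2^T).

Definition e_ n (i j : 'I_n) : sekine n := ([ffun p => (p == (i, j))%:R], 0).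

Definition E_ n (i j : 'I_n) : sekine n := (0, delta_mx i j).

Definition haar n (x : sekine n) : C :=
  (2 * n%:R ^+ 2)^-1 *
  (\sum_(i < n) \sum_(j < n) x.1 (i, j) + n%:R * \sum_(i < n) x.2 i i).

Definition eta (n : nat) : C := expi (2 * pi / n%:R).

Fact ord_shift_subproof n (i : 'I_n) (u : nat) : ((i + u) %% n < n)%N.
Proof. by rewrite ltn_pmod// (leq_ltn_trans _ (ltn_ord i)). Qed.

Definition ord_shift n (i : 'I_n) (u : nat) : 'I_n :=
  Ordinal (ord_shift_subproof i u).

(* The formulas below are those of an irreducible representation when u < n and
   1 <= v <= (n - 1) / 2, which holds for all large n if u and v >= 1 are
   fixed. *)
Definition X11 n (u v : nat) : sekine n :=
  \sum_(i < n) \sum_(j < n) eta n ^ ((i * u)%:Z + (j * v)%:Z) *: e_ i j.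

Definition X12 n (u v : nat) : sekine n :=
  \sum_(i < n) eta n ^ (- (i * v)%:Z) *: E_ i (ord_shift i u).

Definition X21 n (u v : nat) : sekine n :=
  \sum_(i < n) eta n ^ (i * v)%:Z *: E_ i (ord_shift i u).

Definition X22 n (u v : nat) : sekine n :=
  \sum_(i < n) \sum_(j < n) eta n ^ ((i * u)%:Z - (j * v)%:Z) *: e_ i j.

Definition X_ n (u v : nat) : 'M[sekine n]_2 :=
  \matrix_(a < 2, b < 2)
    if a == 0 then (if b == 0 then X11 n u v else X12 n u v)
    else (if b == 0 then X21 n u v else X22 n u v).

Definition chi n (M : 'M[sekine n]_2) : sekine n := \tr M.

(* In a word eps, true stands for the exponent * and false for the empty one. *)
Definition star_word n (x : sekine n) (eps : seq bool) : sekine n :=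
  \prod_(b <- eps) (if b then star x else x).

Definition conj_word (z : C) (eps : seq bool) : C :=
  \prod_(b <- eps) (if b then z^* else z).

Definition cintegrable (m : {measure set C -> \bar R}) (f : C -> C) : Prop :=
  m.-integrable setT (fun z => (complex.Re (f z))%:E) /\
  m.-integrable setT (fun z => (complex.Im (f z))%:E).

Definition cintegral (m : {measure set C -> \bar R}) (f : C -> C) : C :=
  (\int[m]_z complex.Re (f z)) +i* (\int[m]_z complex.Im (f z)).

Definition asymptotic_star_distribution (x : forall n, sekine n)
    (m : {measure set C -> \bar R}) : Prop :=
  m setT = 1%E /\
  forall eps : seq bool,
    cintegrable m (conj_word ^~ eps) /\
    (fun n => haar (star_word (x n) eps) : C^o) @ \oo -->
      (cintegral m (conj_word ^~ eps) : C^o).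

End sekine.

(* Main.v *)
From HB Require Import structures.
Require Import Defs.
From mathcomp Require Import all_boot all_order all_algebra.
From mathcomp Require Import all_classical all_reals all_analysis.
From mathcomp Require Import measurable_realfun complex ring lra zify.

(**
Let k = 2h be even. In the algebra, the diagonal entries of X = X^{u,v} live in
the function summand and its off-diagonal entries in the matrix summand, and the
two summands annihilate each other. Hence X^2 is diagonal and
chi (X^k) = (X11^2 + X12 X21)^h + (X22^2 + X21 X12)^h. With eta = e^{2 i pi / n}
this element has

- function part 2 cos (2 pi k j v / n) eta^{k i u} at the point (i, j)
  ([chi_even_fun]);
- matrix part 2 cos (2 pi u v h / n) S^{k u}, where S is the cyclic shift of
  order n ([chi_even_mx]).

For a word of length m with p letters z and q letters z^*, put d = p - q. Both
parts are a real factor times a unitary, so the word multiplies the real factor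
to the power m and the phase to the power d. Averaging over i gives 1 or 0
according to whether n divides k u d, and so does the normalized trace of
S^{k u d}. Averaging (2 cos (2 pi k j v / n))^m over j keeps only the constant
term of (z + z^{-1})^m as soon as n > k v m; this constant term is called
[central_coef m]. So, for n large, the Haar state of the word is exactly
[k u d = 0] (central_coef m + (2 cos (2 pi u v h / n))^m) / 2
([haar_star_word]), and the last cosine tends to 1.

On the limit side, the substitution x = 2 cos t turns the arcsine weight
1 / sqrt (4 - x^2) into Lebesgue measure ([integral_arcsine]), so that the m-th
arcsine moment is the mean over [0, pi] of (2 cos t)^m, which is again
[central_coef m] by the same binomial expansion. In polar coordinates the moments
of the complex arcsine law factor into a radial arcsine moment over the half
interval and the angular mean of e^{i d t}. The uniform circle contributes
[d = 0] 2^m and the Dirac mass 2^m, which matches the limits above.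
*)

Set Implicit Arguments.
Unset Strict Implicit.
Unset Printing Implicit Defensive.

Import Order.TTheory GRing.Theory Num.Theory numFieldNormedType.Exports.

Local Open Scope classical_set_scope.
Local Open Scope ring_scope.
Local Open Scope complex_scope.

(** * Integrable functions with a prescribed integral *)

Section mean.
Context d (T : measurableType d) (R : realType).
Implicit Types (mu nu : {measure set T -> \bar R}) (f g : T -> R) (a b : R).

(** Integrability and value are carried together because every construction below
(law, mixture, density, product) transports both at once. *)
Definition has_mean mu f a : Prop :=
  mu.-integrable setT (EFin \o f) /\ (\int[mu]_x (f x)%:E = a%:E)%E.

Lemma has_mean_measurable mu f a : has_mean mu f a -> measurable_fun setT f.
Proof. by move=> [/measurable_int/measurable_EFinP]. Qed.

Lemma has_meanZ mu f a c : has_mean mu f a ->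
  has_mean mu (fun x => c * f x) (c * a).
Proof.
move=> [fi fa]; split.
  by have := integrableZl measurableT c fi; apply: eq_integrable.
under eq_integral do rewrite EFinM.
by rewrite integralZl// fa.
Qed.

Lemma has_meanB mu f g a b : has_mean mu f a -> has_mean mu g b ->
  has_mean mu (fun x => f x - g x) (a - b).
Proof.
move=> [fi fa] [gi gb]; split.
  by have := integrableB measurableT fi gi; apply: eq_integrable.
under eq_integral do rewrite EFinB.
by rewrite integralB_EFin// fa gb.
Qed.

Lemma has_mean_ge0 mu f a : (forall x, 0 <= f x) -> measurable_fun setT f ->
  (\int[mu]_x (f x)%:E = a%:E)%E -> has_mean mu f a.
Proof.
move=> f0 mf fa; split=> //; apply/integrableP; split.
  exact/measurable_EFinP.
under eq_integral do rewrite /= ger0_norm//.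
by rewrite fa ltry.
Qed.

Lemma has_mean_dirac (x : T) f : measurable_fun setT f ->
  has_mean (dirac x) f (f x).
Proof.
move=> mf.
have mF : measurable_fun setT (EFin \o f) by exact/measurable_EFinP.
split.
  apply/integrableP; split=> //.
  rewrite integral_dirac//; last exact: measurableT_comp.
  by rewrite diracT mul1e ltry.
by rewrite (integral_dirac x measurableT mF) diracT mul1e.
Qed.

Lemma has_mean_mscale (h : {nonneg R}) mu f a : has_mean mu f a ->
  has_mean (mscale h mu) f (h%:num * a).
Proof.
move=> [/integrableP[mf fi] fa].
have fi' : (mscale h mu).-integrable setT (EFin \o f).
  apply/integrableP; split=> //.
  rewrite ge0_integral_mscale//; last exact: measurableT_comp.
  by rewrite lte_mul_pinfty// lee_fin.
split=> //.
rewrite integralE !ge0_integral_mscale//; last 2 first.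
- exact: measurable_funeneg.
- exact: measurable_funepos.
rewrite -muleBr//.
  by rewrite -integralE fa.
by apply: integrable_add_def => //; apply/integrableP.
Qed.

Lemma has_mean_half_mixture mu nu f a b : has_mean mu f a -> has_mean nu f b ->
  has_mean (half_mixture mu nu) f ((a + b) / 2).
Proof.
move=> /(has_mean_mscale (2^-1)%:nng)[fi fa] /(has_mean_mscale (2^-1)%:nng)[gi gb].
split; last first.
  by rewrite integral_measure_add// fa gb -EFinD -mulrDr mulrC.
have /integrableP[mf fii] := fi; have /integrableP[_ gii] := gi.
apply/integrableP; split=> //.
rewrite ge0_integral_measure_add//; first exact: lte_add_pinfty.
exact: measurableT_comp.
Qed.

(** Measures that agree on measurable sets need not be equal as structures; this
bridges two packagings of the same measure. *)
Lemma eq_has_mean mu nu f a : (forall A, measurable A -> mu A = nu A) ->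
  has_mean mu f a -> has_mean nu f a.
Proof.
move=> e [/integrableP[mf fi] fa]; split.
  apply/integrableP; split=> //.
  by rewrite (eq_measure_integral mu)// => A mA _; rewrite -e.
by rewrite (eq_measure_integral mu)// => A mA _; rewrite -e.
Qed.

End mean.

Lemma has_mean_law d d' (T : measurableType d) (T' : measurableType d')
    (R : realType) (mu : {measure set T -> \bar R}) (g : {mfun T >-> T'})
    (f : T' -> R) (a : R) :
  measurable_fun setT f -> has_mean mu (f \o g) a -> has_mean (law mu g) f a.
Proof.
move=> mf [fi fa].
have mF : measurable_fun setT (EFin \o f) by exact/measurable_EFinP.
split; first exact: (@integrable_pushforward _ _ _ _ _ _ (measurable_funP g) mu setT _ mF).
have := @integral_pushforward _ _ _ _ _ _ (measurable_funP g) mu setT _ mF fi measurableT.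
by rewrite preimage_setT fa.
Qed.

Section density.
Context d (T : measurableType d) (R : realType).
Variables (mu : {measure set T -> \bar R}) (w : {mfun T >-> R}).
Hypothesis w0 : forall x, 0 <= w x.
Local Open Scope ereal_scope.
Import HBNNSimple.

Let mw : measurable_fun setT (EFin \o w).
Proof. exact/measurable_EFinP. Qed.

(** The standard machine: true by definition for indicators, then for simple
functions by linearity, then for all nonnegative functions by monotone
convergence. *)
Lemma ge0_integral_density (f : T -> \bar R) :
  measurable_fun setT f -> (forall x, 0 <= f x) ->
  \int[density_measure mu w0]_x f x = \int[mu]_x (f x * (w x)%:E).
Proof.
move=> mf f0.
pose g := nnsfun_approx measurableT mf.
have indic E : measurable E ->
  \int[density_measure mu w0]_x (\1_E x)%:E = \int[mu]_x ((\1_E x)%:E * (w x)%:E).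
  move=> mE; rewrite integral_indic// setIT [LHS]integral_mkcond.
  apply: eq_integral => x _; rewrite patchE indicE.
  by case: ifPn => _; rewrite ?mul1e ?mul0e.
have mul0 (h : T -> R) : (forall x, 0 <= h x)%R -> forall x, 0 <= (h x)%:E * (w x)%:E.
  by move=> h0 x; rewrite mule_ge0// lee_fin.
have simple (h : {nnsfun T >-> R}) :
  \int[density_measure mu w0]_x (h x)%:E = \int[mu]_x ((h x)%:E * (w x)%:E).
  under [LHS]eq_integral do rewrite fimfunE -fsumEFin//.
  rewrite ge0_integral_fsum//; last 2 first.
    by move=> r; exact/measurable_EFinP/measurableT_comp.
    by move=> n x _; rewrite EFinM nnfun_muleindic_ge0.
  under [RHS]eq_integral.
    move=> x _; rewrite fimfunE -fsumEFin// ge0_mule_fsuml; last first.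
      by move=> r; rewrite EFinM nnfun_muleindic_ge0.
    over.
  rewrite ge0_integral_fsum//; last 2 first.
    move=> r; apply: emeasurable_funM => //.
    by apply/measurable_EFinP; apply/measurableT_comp => //.
    move=> n x _; apply: mule_ge0; last by rewrite lee_fin.
    by rewrite EFinM nnfun_muleindic_ge0.
  apply: eq_fsbigr => r _.
  have [r0|r0] := leP 0%R r; last first.
    rewrite !integral0_eq// => x _;
      by rewrite preimage_nnfun0// indicE in_set0 mulr0 ?mul0e.
  under eq_integral do rewrite EFinM.
  rewrite integralZl_indic_nnsfun//= indic// -ge0_integralZl//.
  - by apply: eq_integral => x _; rewrite EFinM muleA.
  - apply: emeasurable_funM => //; exact/measurable_EFinP/measurable_indic.
  - by move=> x _; apply: mul0 => y; rewrite indicE.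
transitivity (limn (fun n => \int[density_measure mu w0]_x (g n x)%:E)).
  rewrite -monotone_convergence//.
  - apply: eq_integral => x _; apply/esym/cvg_lim => //=; exact: cvg_nnsfun_approx.
  - by move=> n; exact/measurable_EFinP/measurable_funTS.
  - by move=> n x _; rewrite lee_fin.
  - by move=> x _ m n mn; rewrite lee_fin; exact/lefP/nd_nnsfun_approx.
rewrite (_ : (fun n => _) = (fun n => \int[mu]_x ((g n x)%:E * (w x)%:E))); last first.
  by apply/funext => n; exact: simple.
rewrite -monotone_convergence//.
- apply: eq_integral => x _; apply/cvg_lim => //=.
  by apply: cvgeZr => //; exact: cvg_nnsfun_approx.
- move=> n; apply: emeasurable_funM => //; exact/measurable_EFinP/measurable_funTS.
- by move=> n x _; apply: mul0 => y.
- move=> x _ m n mn; rewrite lee_wpmul2r ?lee_fin//; exact/lefP/nd_nnsfun_approx.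
Qed.

Lemma has_mean_density (f : T -> R) (a : R) : measurable_fun setT f ->
  has_mean mu (fun x => f x * w x)%R a -> has_mean (density_measure mu w0) f a.
Proof.
move=> mf [fi fa].
have mF : measurable_fun setT (EFin \o f) by exact/measurable_EFinP.
split.
  apply/integrableP; split=> //.
  rewrite ge0_integral_density//; last exact: measurableT_comp.
  move/integrableP : fi => [_]; under eq_integral do rewrite /= normrM EFinM.
  by under [in X in X -> _]eq_integral do rewrite (ger0_norm (w0 _)).
rewrite integralE !ge0_integral_density//; last 2 first.
- exact: measurable_funeneg.
- exact: measurable_funepos.
rewrite -fa [RHS]integralE; congr (_ - _); apply: eq_integral => x _.
- rewrite !funeposE /= -!EFin_max -EFinM; congr EFin.
  by rewrite maxr_pMl// mul0r.
- rewrite !funenegE /= -!EFin_max -EFinM; congr EFin.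
  by rewrite maxr_pMl// mul0r mulNr.
Qed.
End density.

(** Tonelli gives the integrability of the product, and then Fubini its integral;
this is what separates radius and angle. *)
Lemma has_mean_prod d1 d2 (T1 : measurableType d1) (T2 : measurableType d2)
    (R : realType) (m1 : {sigma_finite_measure set T1 -> \bar R})
    (m2 : {sigma_finite_measure set T2 -> \bar R}) (f : T1 -> R) (g : T2 -> R)
    (a b : R) :
  has_mean m1 f a -> has_mean m2 g b ->
  has_mean (m1 \x m2)%E (fun p => f p.1 * g p.2) (a * b).
Proof.
move=> hf hg; have mf := has_mean_measurable hf; have mg := has_mean_measurable hg.
have mfg : measurable_fun setT (EFin \o (fun p : T1 * T2 => f p.1 * g p.2)).
  apply/measurable_EFinP; apply: measurable_funM.
  - exact: (measurableT_comp mf measurable_fst).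
  - exact: (measurableT_comp mg measurable_snd).
case: hf => /integrableP[mF fi] fa; case: hg => gi gb.
have gi' : (\int[m2]_y `|(g y)%:E| \is a fin_num)%E.
  by rewrite ge0_fin_numE ?integral_ge0//; case/integrableP: gi.
have I : (m1 \x m2)%E.-integrable setT (EFin \o (fun p => f p.1 * g p.2)).
  apply/(integrable12ltyP _ _ mfg).
  under eq_integral => x _.
    under eq_integral do rewrite /= normrM EFinM.
    rewrite ge0_integralZl//; last by apply/measurable_EFinP/measurableT_comp.
    over.
  rewrite /=.
  under eq_integral do rewrite -(fineK gi') muleC.
  rewrite ge0_integralZl//; last 2 first.
  - by apply/measurable_EFinP/measurableT_comp.
  - by rewrite fineK// integral_ge0.
  by rewrite lte_mul_pinfty// fineK// integral_ge0.
split=> //.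
rewrite -integral12_prod_meas1// /fubini_F.
under eq_integral => x _.
  under eq_integral do rewrite /= EFinM.
  rewrite integralZl// gb.
  over.
rewrite /= integralZr//; last by apply/integrableP.
by rewrite fa.
Qed.

(** * Trigonometric integrals *)

Section calculus.
Context {R : realType}.
Notation mu := (@lebesgue_measure R).

Lemma integral_is_derive (F f : R -> R) (a b : R) : a < b -> continuous f ->
  (forall x : R, is_derive x 1 F (f x)) ->
  (\int[mu]_(x in `[a, b]) (f x)%:E = (F b - F a)%:E)%E.
Proof.
move=> ab cf dF.
have cF : continuous F.
  by move=> x; apply/differentiable_continuous/derivable1_diffP/ex_derive.
rewrite (@continuous_FTC2 _ f F)//.
- exact: continuous_subspaceT.
- split=> [x _| |]; first exact: ex_derive.
  + exact/cvg_at_right_filter/cF.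
  + exact/cvg_at_left_filter/cF.
- by move=> x _; rewrite derive1E derive_val.
Qed.

(** Both endpoint conventions occur: the uniform density is supported on a closed
interval, the polar arcsine density on open ones. *)
Lemma has_mean_itv (f : R -> R) (a b c : R) (b0 b1 : bool) : continuous f ->
  (\int[mu]_(x in `[a, b]) (f x)%:E = c%:E)%E ->
  has_mean mu (fun x => f x * \1_([set` Interval (BSide b0 a) (BSide b1 b)]) x) c.
Proof.
move=> cf fc.
set I := [set` _].
have mI : measurable I by exact: measurable_itv.
have E : EFin \o (fun x => f x * \1_I x) = (EFin \o f) \_ I.
  apply/funext => x.
  by rewrite patchE /= indicE; case: ifPn => _; rewrite ?mulr1 ?mulr0.
have If : mu.-integrable I (EFin \o f).
  apply: (@integrableS _ (measurableTypeR R) R mu `[a, b]%classic I (EFin \o f)) => //.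
    by apply: subset_itv; rewrite bnd_simp.
  apply: continuous_compact_integrable; first exact: segment_compact.
  exact: continuous_subspaceT.
rewrite /has_mean E; split; first exact: ((@integrable_mkcond _ _ R mu I (EFin \o f) mI).1 If).
transitivity (\int[mu]_x ((EFin \o f) \_ I) x)%E.
  by apply: eq_integral => x _; rewrite -E.
rewrite -integral_mkcond integral_itv_bndoo; last first.
  apply/measurable_EFinP/measurable_funTS; exact: continuous_measurable_fun.
rewrite -fc [RHS](@integral_itv_bndoo _ _ _ _ true false)//.
apply/measurable_EFinP/measurable_funTS; exact: continuous_measurable_fun.
Qed.

(** A single formula valid for every frequency c, so that a trigonometric sum can
be integrated term by term, constant term included. *)
Definition cos_primitive (c t : R) : R := if c == 0 then t else sin (c * t) / c.

Definition sin_primitive (c t : R) : R := if c == 0 then 0 else - cos (c * t) / c.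

Lemma is_derive_mull (c t : R) : is_derive t (1 : R) (fun x : R => c * x) c.
Proof.
have := @is_deriveZ R R R id c t 1 1 (is_derive_id _ _).
by rewrite /GRing.scale/= mulr1.
Qed.

Lemma is_derive_cos_primitive (c t : R) :
  is_derive t 1 (cos_primitive c) (cos (c * t)).
Proof.
rewrite /cos_primitive; have [->|c0] := eqVneq c 0.
  by rewrite mul0r cos0; exact: is_derive_id.
have := is_deriveZ c^-1 (is_derive1_comp (is_derive_sin (c * t)) (is_derive_mull c t)).
rewrite /GRing.scale/= mulrCA mulVf// mulr1.
rewrite (_ : _ \*: _ = (fun t => sin (c * t) / c))//.
by apply/funext => x; rewrite mulrC.
Qed.

Lemma is_derive_sin_primitive (c t : R) :
  is_derive t 1 (sin_primitive c) (sin (c * t)).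
Proof.
rewrite /sin_primitive; have [->|c0] := eqVneq c 0.
  by rewrite mul0r sin0; exact: is_derive_cst.
have := is_deriveZ (- c^-1) (is_derive1_comp (is_derive_cos (c * t)) (is_derive_mull c t)).
rewrite /GRing.scale/= mulNr mulNr mulrN opprK mulrCA mulVf// mulr1.
rewrite (_ : _ \*: _ = (fun t => - cos (c * t) / c))//.
by apply/funext => x; rewrite mulNr mulrC -mulNr.
Qed.

Lemma continuous_cosM (c : R) : continuous (fun t : R => cos (c * t)).
Proof.
move=> t; apply: (@continuous_comp _ _ _ (fun t => c * t) cos).
  by apply: cvgMr; exact: cvg_id.
exact: continuous_cos.
Qed.

Lemma continuous_sinM (c : R) : continuous (fun t : R => sin (c * t)).
Proof.
move=> t; apply: (@continuous_comp _ _ _ (fun t => c * t) sin).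
  by apply: cvgMr; exact: cvg_id.
exact: continuous_sin.
Qed.

End calculus.

Section expi.
Context {R : realType}.
Implicit Types (s t : R).

Lemma expiD s t : expi (s + t) = expi s * expi t.
Proof.
rewrite /expi cosD sinD; simpc.
by rewrite [X in _ +i* X]addrC.
Qed.

Lemma expi0 : expi 0 = 1 :> R[i].
Proof. by rewrite /expi cos0 sin0. Qed.

Lemma expiX t n : expi t ^+ n = expi (n%:R * t).
Proof.
elim: n => [|n IH]; first by rewrite mul0r expi0.
by rewrite exprSr IH -expiD -natr1 mulrDl mul1r.
Qed.

Lemma conj_expi t : (expi t)^*%C = expi (- t).
Proof. by rewrite /expi cosN sinN. Qed.

Lemma expi_add_conj t : expi t + expi (- t) = (2 * cos t)%:C.
Proof. by apply/eqP; rewrite eq_complex /= cosN sinN subrr eqxx mulr_natl mulr2n eqxx. Qed.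

(** Binomial expansion of (z + z^{-1})^m at z = e^{it}. It computes both the
integrals of (2 cos t)^m and its averages over roots of unity. *)
Lemma two_cosX t m : (2 * cos t)%:C ^+ m =
  \sum_(l < m.+1) 'C(m, l)%:R * expi ((m%:R - l.*2%:R) * t).
Proof.
rewrite -expi_add_conj exprDn; apply: eq_bigr => l _.
rewrite !expiX -expiD [RHS]mulr_natl; congr (_ *+ _); congr expi.
rewrite natrB; last by rewrite -ltnS.
by rewrite -addnn natrD; ring.
Qed.

Lemma two_cosXr t m : (2 * cos t) ^+ m =
  \sum_(l < m.+1) 'C(m, l)%:R * cos ((m%:R - l.*2%:R) * t).
Proof.
have ReD (x y : R[i]) : complex.Re (x + y) = complex.Re x + complex.Re y.
  by case: x y => ? ? [].
have := congr1 (@complex.Re R) (two_cosX t m).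
rewrite -rmorphXn /= => ->.
rewrite (big_morph _ ReD (erefl : complex.Re 0 = 0)).
by apply: eq_bigr => l _; rewrite -(rmorph_nat (real_complex R)) /= mul0r subr0.
Qed.

End expi.

(** The constant term of (z + z^{-1})^m: the central binomial coefficient if m is
even, and 0 otherwise. At most one index l contributes. *)
Definition central_coef (m : nat) : nat := \sum_(l < m.+1 | l.*2 == m) 'C(m, l).

Section cos_moments.
Context {R : realType}.
Notation mu := (@lebesgue_measure R).

Lemma continuous_two_cos : continuous (fun t : R => 2 * cos t).
Proof. by move=> t; apply: cvgMr; exact: continuous_cos. Qed.

Lemma continuous_comp_two_cos (g : R -> R) : continuous g ->
  continuous (fun t : R => g (2 * cos t)).
Proof.
move=> cg t; apply: (@continuous_comp _ _ _ (fun t : R => 2 * cos t) g).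
  exact: continuous_two_cos.
exact: cg.
Qed.

(** Every nonconstant frequency of (2 cos t)^m has a primitive vanishing at both
ends, so only the constant term is left. *)
Lemma integral_two_cosX (m : nat) (b : R) : 0 < b ->
  (forall l : 'I_m.+1, sin ((m%:R - l.*2%:R) * b) = 0) ->
  (\int[mu]_(t in `[0%R, b]) ((2 * cos t) ^+ m)%:E = (b * (central_coef m)%:R)%:E)%E.
Proof.
move=> b0 hb.
pose F := \sum_(l < m.+1) ('C(m, l)%:R \*: cos_primitive (m%:R - l.*2%:R) : R -> R).
have FE x : F x = \sum_(l < m.+1) 'C(m, l)%:R * cos_primitive (m%:R - l.*2%:R) x.
  by rewrite /F fct_sumE.
have cf : continuous (fun t : R => (2 * cos t) ^+ m).
  exact: (continuous_comp_two_cos (@exprn_continuous R m)).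
have dF (t : R) : is_derive t (1 : R) F ((2 * cos t) ^+ m).
  rewrite two_cosXr; apply: is_derive_sum => l.
  by apply: is_deriveZ; exact: is_derive_cos_primitive.
rewrite (integral_is_derive b0 cf dF).
congr EFin; rewrite !FE -sumrB /central_coef natr_sum mulr_sumr [RHS]big_mkcond/=.
apply: eq_bigr => l _; rewrite /cos_primitive hb mulr0 sin0 !mul0r.
rewrite subr_eq0 eqr_nat eq_sym.
by case: eqP => _; rewrite ?mulr0 subr0 ?mulr0// mulrC.
Qed.

Lemma sin_nat_pi n : sin (n%:R * pi) = 0 :> R.
Proof.
elim: n => [|n IH]; first by rewrite mul0r sin0.
by rewrite -natr1 mulrDl mul1r sinDpi IH oppr0.
Qed.

Lemma sin_int_pi (z : int) : sin (z%:~R * pi) = 0 :> R.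
Proof.
case: z => n; first exact: sin_nat_pi.
by rewrite NegzE mulrNz mulNr sinN sin_nat_pi oppr0.
Qed.

Lemma integral_pi_two_cosX m :
  (\int[mu]_(t in `[0%R, pi]) ((2 * cos t) ^+ m)%:E = (pi * (central_coef m)%:R)%:E)%E.
Proof.
apply: integral_two_cosX => [|l]; first exact: pi_gt0.
by have := sin_int_pi (m%:Z - l.*2%:Z); rewrite rmorphB.
Qed.

(** On the half interval the frequencies m - 2l must be even for their primitives to
vanish at pi / 2. *)
Lemma integral_pihalf_two_cosX m : ~~ odd m ->
  (\int[mu]_(t in `[0%R, (pi / 2)%R]) ((2 * cos t) ^+ m)%:E = (pi / 2 * (central_coef m)%:R)%:E)%E.
Proof.
move=> /even_halfK m_even; apply: integral_two_cosX => [|l].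
  by rewrite divr_gt0// pi_gt0.
have mE : m%:R = m./2%:R * 2 :> R by rewrite -[in LHS]m_even -muln2 natrM.
rewrite mE -muln2 natrM -mulrBl -mulrA [2 * _]mulrC divfK//.
by have := sin_int_pi (m./2%:Z - l%:Z); rewrite rmorphB.
Qed.

End cos_moments.

Section arcsine_substitution.
Context {R : realType}.
Notation mu := (@lebesgue_measure R).
Implicit Types a b x : R.

(** The arcsine weight up to the constant; it is 0 outside (-2, 2), the square root
being 0 there. *)
Definition inv_semicircle (x : R) := (Num.sqrt (2 ^+ 2 - x ^+ 2))^-1.

Lemma in_arcsine_support a b x : `]2 * cos b, 2 * cos a[%classic x -> -2 < x < 2.
Proof.
rewrite /= in_itv/= => /andP[h1 h2].
have := cos_geN1 b; have := cos_le1 a; move=> *; lra.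
Qed.

Lemma continuous_inv_semicircle (x : R) : -2 < x < 2 -> {for x, continuous inv_semicircle}.
Proof.
move=> hx; have hx' : 0 < 2 ^+ 2 - x ^+ 2 by nra.
apply: (@continuous_comp _ _ _
  (Num.sqrt \o (fun x : R => 2 ^+ 2 - x ^+ 2)) GRing.inv); last first.
  by apply: inv_continuous; rewrite gt_eqF// sqrtr_gt0.
apply: continuous_comp; last exact: sqrt_continuous.
by apply: cvgB; [exact: cvg_cst|exact: exprn_continuous].
Qed.

(** Away from the singular points -2 and 2 this is ordinary substitution: with
x = 2 cos t, one has sqrt (4 - x^2) = 2 sin t, which cancels the Jacobian. *)
Lemma integral_arcsine_closed (g : R -> R) (s t : R) : continuous g ->
  0 < s -> s < t -> t < pi ->
  (\int[mu]_(x in `[(2 * cos t)%R, (2 * cos s)%R]) (g x * inv_semicircle x)%:E =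
   \int[mu]_(x in `[s, t]) (g (2 * cos x))%:E)%E.
Proof.
move=> cg s0 st tpi.
have mem x : s <= x <= t -> 0 <= x <= pi by move=> *; lra.
have D x : is_derive x (1 : R) (fun x : R => 2 * cos x) (- (2 * sin x)).
  have := @is_deriveZ R R R cos 2 x 1 _ (is_derive_cos x).
  by rewrite /GRing.scale/= mulrN.
have D1 : derive1 (fun x : R => 2 * cos x) = (fun x => - (2 * sin x)).
  by apply/funext => x; rewrite derive1E derive_val.
have cD : continuous (fun x : R => - (2 * sin x)).
  by move=> x; apply: cvgN; apply: cvgMr; exact: continuous_sin.
have cc := @continuous_two_cos R.
rewrite (@integration_by_substitution_decreasing _ (fun x => 2 * cos x)).
- apply: eq_integral => x; rewrite inE/= in_itv/= => hx.
  have sx : 0 < sin x by apply: sin_gt0_pi; lra.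
  congr EFin; rewrite D1 !fctE /inv_semicircle /= opprK.
  rewrite (_ : 2 ^+ 2 - (2 * cos x) ^+ 2 = (2 * sin x) ^+ 2); last first.
    by rewrite !exprMn sin2cos2; ring.
  rewrite sqrtr_sqr ger0_norm; last by nra.
  by rewrite mulfVK// gt_eqF// mulr_gt0.
- exact: ltW.
- move=> x y /[!in_itv]/= hx hy xy; rewrite ltr_pM2l// ltr_cos ?in_itv//=; exact: mem.
- by move=> x _; rewrite D1; exact: cD.
- by rewrite D1; apply: cvgP; exact/cvg_at_right_filter/cD.
- by rewrite D1; apply: cvgP; exact/cvg_at_left_filter/cD.
- split; first by [].
  + exact/cvg_at_right_filter/cc.
  + exact/cvg_at_left_filter/cc.
- apply: continuous_in_subspaceT => x; rewrite inE/= in_itv/= => hx.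
  apply: cvgM; first exact: cg.
  apply: continuous_inv_semicircle.
  have t1 : -1 < cos t by rewrite -cospi ltr_cos ?in_itv/= ?lexx ?pi_ge0//; lra.
  have s1 : cos s < 1 by rewrite -cos0 ltr_cos ?in_itv/= ?lexx ?pi_ge0//; lra.
  by lra.
Qed.

Lemma acos_half a b x : 0 <= a -> a < b -> b <= pi ->
  `]2 * cos b, 2 * cos a[%classic x ->
  a < acos (x / 2) < b /\ 2 * cos (acos (x / 2)) = x.
Proof.
move=> a0 ab bpi Ix; have /andP[x1 x2] := in_arcsine_support Ix.
have hx : -1 <= x / 2 <= 1 by lra.
have e : cos (acos (x / 2)) = x / 2 by rewrite acosK.
split; last by rewrite e; field.
have hin : acos (x / 2) \in `[0, pi] by rewrite in_itv/= acos_ge0// acos_lepi.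
move: Ix; rewrite /= in_itv/= => /andP[h1 h2].
by apply/andP; split; rewrite -ltr_cos ?in_itv//= ?e; lra.
Qed.

(** The weight is singular at -2 and 2, so the substitution is done on closed
intervals exhausting the open one, and both sides converge monotonically because
g is nonnegative. *)
Lemma integral_arcsine a b (g : R -> R) : 0 <= a -> a < b -> b <= pi ->
  continuous g ->
  (forall x, -2 < x < 2 -> 0 <= g x) ->
  (\int[mu]_(x in `](2 * cos b)%R, (2 * cos a)%R[) (g x * inv_semicircle x)%:E =
   \int[mu]_(x in `[a, b]) (g (2 * cos x))%:E)%E.
Proof.
move=> a0 ab bpi cg g0.
set I := `]2 * cos b, 2 * cos a[%classic.
(* The shift n.+3 keeps a + e n strictly below b - e n already for n = 0. *)
pose e (n : nat) := (b - a) / n.+3%:R.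
have e0 n : 0 < e n by rewrite divr_gt0 ?subr_gt0.
have e3 n : e n * 3 <= b - a.
  rewrite /e mulrAC ler_pdivrMr// ler_wpM2l ?subr_ge0 ?(ltW ab)//.
  by rewrite ler_nat.
have le_e n m : (n <= m)%N -> e m <= e n.
  move=> nm; rewrite ler_wpM2l ?subr_ge0 ?(ltW ab)//.
  by rewrite lef_pV2 ?posrE// ler_nat !ltnS.
have ex_e x : 0 < x -> exists n, e n <= x.
  move=> x0; exists (Num.truncn ((b - a) / x)).
  rewrite ler_pdivrMr// mulrC -ler_pdivrMr//.
  rewrite (le_trans (ltW (truncnS_gt _)))// ler_nat; by rewrite ltnS !leqW.
have ce n : [/\ 0 < a + e n, a + e n < b - e n & b - e n < pi].
  by have := e0 n; have := e3 n; split; lra.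
pose F n : set R := `[2 * cos (b - e n), 2 * cos (a + e n)]%classic.
pose G n : set R := `[a + e n, b - e n]%classic.
have UG : \bigcup_n G n = `]a, b[%classic.
  apply/seteqP; split=> x /=.
    move=> [n _]; rewrite /G /= !in_itv/= => /andP[h1 h2].
    by have := e0 n; lra.
  rewrite in_itv/= => /andP[ax xb].
  have [n hn] := ex_e (x - a) ltac:(lra); have [m hm] := ex_e (b - x) ltac:(lra).
  exists (maxn n m) => //; rewrite /G/= in_itv/=.
  have := le_e _ _ (leq_maxl n m); have := le_e _ _ (leq_maxr n m).
  by lra.
have UF : \bigcup_n F n = I.
  apply/seteqP; split=> x.
    move=> [n _]; rewrite /F /I /= !in_itv/= => /andP[h1 h2].
    have [p1 p2 p3] := ce n; have p4 := e0 n.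
    have q1 : cos b < cos (b - e n) by rewrite ltr_cos ?in_itv/=; lra.
    have q2 : cos (a + e n) < cos a by rewrite ltr_cos ?in_itv/=; lra.
    by lra.
  move=> Ix; have [hx xE] := acos_half a0 ab bpi Ix.
  have : (`]a, b[%classic : set R) (acos (x / 2)) by rewrite /= in_itv.
  rewrite -UG => -[n _]; rewrite /G /= in_itv/= => /andP[h1 h2]; exists n => //.
  rewrite /F/= in_itv/= -xE.
  have [p1 p2 p3] := ce n.
  by rewrite !ler_pM2l// !(leNgt (cos _)) !ltr_cos ?in_itv/= -?leNgt; lra.
have cgc := continuous_comp_two_cos cg.
have cW x : -2 < x < 2 -> {for x, continuous (fun x => g x * inv_semicircle x)}.
  by move=> hx; apply: cvgM; [exact: cg|exact: continuous_inv_semicircle].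
have W0 x : -2 < x < 2 -> 0 <= g x * inv_semicircle x.
  by move=> hx; rewrite mulr_ge0 ?g0// invr_ge0 sqrtr_ge0.
have sF n x : F n x -> -2 < x < 2.
  move=> Fx; apply: (@in_arcsine_support a b).
  by rewrite -/I -UF; exists n.
have sG n x : G n x -> -2 < 2 * cos x < 2.
  move=> Gx; apply: (@in_arcsine_support a b).
  have : (`]a, b[%classic : set R) x by rewrite -UG; exists n.
  rewrite /= !in_itv/= !ltr_pM2l// => /andP[h1 h2].
  by rewrite !ltr_cos ?in_itv/=; lra.
have FG n : (\int[mu]_(x in F n) (g x * inv_semicircle x)%:E =
             \int[mu]_(x in G n) (g (2 * cos x))%:E)%E.
  by have [p1 p2 p3] := ce n; exact: integral_arcsine_closed.
have Fcvg : (\int[mu]_(x in F n) (g x * inv_semicircle x)%:E)%E @[n --> \oo] -->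
    (\int[mu]_(x in I) (g x * inv_semicircle x)%:E)%E.
  rewrite -UF; apply: ge0_nondecreasing_set_cvg_integral => [n m nm|n|n|n x Fx].
  - rewrite subsetEset => x; rewrite /F /= !in_itv/= => /andP[h1 h2].
    have := le_e _ _ nm; have [p1 p2 p3] := ce n; have [p4 p5 p6] := ce m => enm.
    have q1 : cos (b - e m) <= cos (b - e n).
      by rewrite leNgt ltr_cos ?in_itv/= -?leNgt; lra.
    have q2 : cos (a + e n) <= cos (a + e m).
      by rewrite leNgt ltr_cos ?in_itv/= -?leNgt; lra.
    by lra.
  - exact: measurable_itv.
  - apply/measurable_EFinP; apply: subspace_continuous_measurable_fun.
      exact: measurable_itv.
    by apply: continuous_in_subspaceT => x /set_mem /sF; exact: cW.
  - by rewrite lee_fin; exact: W0 (sF _ _ Fx).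
have Gcvg : (\int[mu]_(x in G n) (g (2 * cos x))%:E)%E @[n --> \oo] -->
    (\int[mu]_(x in `]a, b[) (g (2 * cos x))%:E)%E.
  rewrite -UG; apply: ge0_nondecreasing_set_cvg_integral => [n m nm|n|n|n x Gx].
  - rewrite subsetEset => x; rewrite /G /= !in_itv/=.
    by have := le_e _ _ nm; lra.
  - exact: measurable_itv.
  - apply/measurable_EFinP/measurable_funTS; exact: continuous_measurable_fun.
  - by rewrite lee_fin; exact: g0 (sG _ _ Gx).
rewrite [RHS](@integral_itv_bndoo _ _ _ _ true false); last first.
  by apply/measurable_EFinP/measurable_funTS; exact: continuous_measurable_fun.
apply: cvg_unique Fcvg _ => //.
by rewrite (_ : (fun n => _) = fun n => \int[mu]_(x in G n) (g (2 * cos x))%:E)%E//; apply/funext.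
Qed.

(** A signed g is reduced to the nonnegative case by adding a constant K that
dominates it. *)
Lemma has_mean_arcsine a b (g : R -> R) (c K : R) : 0 <= a -> a < b -> b <= pi ->
  continuous g -> (forall x, -2 < x < 2 -> `|g x| <= K) ->
  (\int[mu]_(x in `[a, b]) (g (2 * cos x))%:E = c%:E)%E ->
  has_mean mu (fun x => g x * (\1_(`]2 * cos b, 2 * cos a[%classic) x * inv_semicircle x)) c.
Proof.
move=> a0 ab bpi cg gK gc.
set I := `]2 * cos b, 2 * cos a[%classic.
have mI : measurable I by exact: measurable_itv.
pose w x := \1_I x * inv_semicircle x.
have w0 x : 0 <= w x by rewrite mulr_ge0// invr_ge0 sqrtr_ge0.
have wI x : x \notin I -> w x = 0 by move=> /negbTE h; rewrite /w indicE h mul0r.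
have mw : measurable_fun setT w.
  (* On I the weight is a multiple of the arcsine density, already known to be
     measurable. *)
  rewrite (_ : w = fun x => \1_I x * (pi * arcsine_pdf 2 x)).
    apply: measurable_funM; first exact: measurable_indic.
    by apply: measurable_funM => //; exact: (measurable_funP (arcsine_pdf 2)).
  apply/funext => x; rewrite /w !indicE; have [|] := boolP (x \in I); rewrite ?mul0r//.
  move=> /set_mem/in_arcsine_support hx.
  rewrite /arcsine_pdf indicE mem_set ?mul1r/=; last by rewrite in_itv.
  by rewrite invfM mulVKf// gt_eqF// pi_gt0.
have pos (f : R -> R) (s : R) : continuous f -> (forall x, -2 < x < 2 -> 0 <= f x) ->
    (\int[mu]_(x in `[a, b]) (f (2 * cos x))%:E = s%:E)%E ->
    has_mean mu (fun x => f x * w x) s.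
  move=> cf f0 fs; apply: has_mean_ge0 => [x| |].
  - have [/set_mem/in_arcsine_support hx|/wI ->] := boolP (x \in I); last by rewrite mulr0.
    by rewrite mulr_ge0 ?f0.
  - by apply: measurable_funM => //; exact: continuous_measurable_fun.
  - rewrite -fs -integral_arcsine// -/I [RHS]integral_mkcond.
    apply: eq_integral => x _; rewrite patchE /w indicE.
    by case: ifPn => _; rewrite ?mul1r// mul0r mulr0.
have constK (s : R) : (\int[mu]_(x in `[a, b]) (s%:E) = (s * (b - a))%:E)%E.
  by rewrite integral_cst//= lebesgue_measure_itv/= lte_fin ab.
have hK : has_mean mu (fun x => K * w x) (K * (b - a)).
  apply: pos; [exact: cst_continuous| |exact: constK].
  by move=> x hx; rewrite (le_trans _ (gK x hx)).
have cgK : continuous (fun x => g x + K).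
  by move=> x; apply: cvgD; [exact: cg|exact: cvg_cst].
have hgK : has_mean mu (fun x => (g x + K) * w x) (c + K * (b - a)).
  apply: pos => // [x hx|].
    by have := gK x hx; rewrite ler_norml; lra.
  under eq_integral do rewrite EFinD.
  have cgc := continuous_comp_two_cos cg.
  rewrite integralD//.
  - by rewrite gc constK.
  - apply: continuous_compact_integrable; first exact: segment_compact.
    exact: continuous_subspaceT.
  - apply: continuous_compact_integrable; first exact: segment_compact.
    by apply: continuous_subspaceT; exact: cst_continuous.
have := has_meanB hgK hK.
rewrite addrK (_ : (fun x => _ - _) = (fun x => g x * w x))//.
by apply/funext => x; rewrite mulrDl addrK.
Qed.

End arcsine_substitution.

(** * Star-moments of the limit laws *)

(** The number of letters z minus the number of letters z^*: the exponent with which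
the phase of z enters the word. *)
Definition word_charge (eps : seq bool) : int := \sum_(b <- eps) (if b then -1 else 1).

Lemma word_charge_cons b eps : word_charge (b :: eps) = (if b then -1 else 1) + word_charge eps.
Proof. by rewrite /word_charge big_cons. Qed.

(** Charge and length have the same parity. *)
Lemma word_charge0_even eps : word_charge eps = 0 -> ~~ odd (size eps).
Proof.
suff : odd `|word_charge eps|%N = odd (size eps) by move=> <- ->.
elim: eps => [|b eps IH]; first by rewrite /word_charge big_nil.
by rewrite word_charge_cons /= -IH; case: b; lia.
Qed.

Section words.
Context {R : realType}.
Implicit Types (z : R[i]) (eps : seq bool).

Lemma conj_word_cons z b eps :
  conj_word z (b :: eps) = (if b then (z^*)%R else z) * conj_word z eps.
Proof. by rewrite /conj_word big_cons. Qed.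

Lemma conj_word_polar (r t : R) eps :
  conj_word (r%:C * expi t) eps =
  (r ^+ size eps)%:C * expi ((word_charge eps)%:~R * t).
Proof.
elim: eps => [|b eps IH].
  by rewrite /conj_word /word_charge !big_nil mul0r expi0 mulr1.
rewrite conj_word_cons {}IH word_charge_cons /= exprS.
rewrite (rmorphM (real_complex R)) /= rmorphD/= mulrDl expiD.
rewrite [RHS]mulrACA; congr (_ * _); case: b; last by rewrite mul1r.
rewrite (rmorphM Num.conj) mulN1r /=; congr (_ * _); first exact: conjc_real.
exact: conj_expi.
Qed.

Lemma conj_word_real (x : R) eps : conj_word x%:C eps = (x ^+ size eps)%:C.
Proof. by have := conj_word_polar x 0 eps; rewrite mulr0 expi0 !mulr1. Qed.

(** The sigma-algebra on the complex plane is transported from R * R, so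
measurability is tested in Cartesian coordinates. *)
Lemma measurable_complex_fun (f : R[i] -> R) :
  measurable_fun setT (fun p : R * R => f (complex_of_pair p)) ->
  measurable_fun setT f.
Proof.
move=> mf _ A mA; have := mf measurableT A mA.
by rewrite !setTI.
Qed.

(** The real and imaginary parts of a word are polynomials in those of z; as these
polynomials mix under multiplication, the two are treated together. *)
Lemma measurable_conj_word eps :
  measurable_fun setT (fun z : R[i] => complex.Re (conj_word z eps)) /\
  measurable_fun setT (fun z : R[i] => complex.Im (conj_word z eps)).
Proof.
have mRe : measurable_fun setT (@complex.Re R).
  by apply: measurable_complex_fun; exact: measurable_fst.
have mIm : measurable_fun setT (@complex.Im R).
  by apply: measurable_complex_fun; exact: measurable_snd.
have mReb (b : bool) : measurable_fun setT (fun z : R[i] => complex.Re (if b then (z^*)%R else z)).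
  by case: b => //; apply: eq_measurable_fun mRe => -[].
have mImb (b : bool) : measurable_fun setT (fun z : R[i] => complex.Im (if b then (z^*)%R else z)).
  by case: b => //; apply: eq_measurable_fun (measurable_funN mIm) => -[].
have ReM (x y : R[i]) : complex.Re (x * y) =
  complex.Re x * complex.Re y - complex.Im x * complex.Im y by case: x y => ? ? [].
have ImM (x y : R[i]) : complex.Im (x * y) =
  complex.Re x * complex.Im y + complex.Im x * complex.Re y by case: x y => ? ? [].
elim: eps => [|b eps [IHr IHi]].
  by split; under eq_fun do rewrite /conj_word big_nil; exact: measurable_cst.
split.
- under eq_fun do rewrite conj_word_cons ReM.
  by apply: measurable_funB; apply: measurable_funM.
- under eq_fun do rewrite conj_word_cons ImM.
  by apply: measurable_funD; apply: measurable_funM.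
Qed.

Definition has_moment (m : {measure set R[i] -> \bar R}) eps z : Prop :=
  has_mean m (fun x => complex.Re (conj_word x eps)) (complex.Re z) /\
  has_mean m (fun x => complex.Im (conj_word x eps)) (complex.Im z).

Lemma has_moment_half_mixture m1 m2 eps (s t : R) :
  has_moment m1 eps s%:C -> has_moment m2 eps t%:C ->
  has_moment (half_mixture m1 m2) eps ((s + t) / 2)%:C.
Proof.
move=> [r1 i1] [r2 i2]; split; first exact: has_mean_half_mixture.
by have := has_mean_half_mixture i1 i2; rewrite /= addr0 mul0r.
Qed.

Lemma has_moment_law d (T : measurableType d) (mu : {measure set T -> \bar R})
    (g : {mfun T >-> R[i]}) eps z :
  has_mean mu (fun x => complex.Re (conj_word (g x) eps)) (complex.Re z) ->
  has_mean mu (fun x => complex.Im (conj_word (g x) eps)) (complex.Im z) ->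
  has_moment (law mu g) eps z.
Proof.
by have [mr mi] := measurable_conj_word eps; split; exact: has_mean_law.
Qed.

(** The moment of the empty word is the total mass, so mom [::] = 1 says that m is a
probability measure. *)
Lemma asymptotic_star_distributionP (x : forall n, sekine n)
    (m : {measure set R[i] -> \bar R}) (mom : seq bool -> R[i]) :
  (forall eps, has_moment m eps (mom eps)) -> mom [::] = 1 ->
  (forall eps, (fun n => haar (star_word (x n) eps) : R[i]^o) @ \oo -->
     (mom eps : R[i]^o)) ->
  asymptotic_star_distribution x m.
Proof.
move=> hm m0 hx; split.
  have [[_ +] _] := hm [::]; rewrite m0.
  under eq_integral do rewrite /conj_word big_nil.
  by rewrite /= integral_cst// mul1e.
move=> eps; have [[ri re] [ii ie]] := hm eps; split; first by split.
suff -> : cintegral m (conj_word ^~ eps) = mom eps by exact: hx.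
rewrite /cintegral /Rintegral.
by rewrite re ie /=; case: (mom eps).
Qed.

End words.

Section moments.
Context {R : realType}.
Notation mu := (@lebesgue_measure R).

Lemma cos_int_2pi (c : int) : cos (c%:~R * (2 * pi)) = 1 :> R.
Proof.
rewrite mulrCA mulr_natl cos_mulr2n cos2sin2 sin_int_pi expr0n/= subr0.
by rewrite mulr2n addrK.
Qed.

Lemma twopi_gt0 : 0 < 2 * pi :> R.
Proof. by rewrite mulr_gt0// pi_gt0. Qed.

Lemma integral_cos_int (c : int) :
  (\int[mu]_(t in `[0%R, (2 * pi)%R]) (cos (c%:~R * t))%:E =
   (2 * pi * (c == 0)%:R)%:E)%E.
Proof.
rewrite (integral_is_derive twopi_gt0 (@continuous_cosM R _)
  (@is_derive_cos_primitive R _)).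
congr EFin; rewrite /cos_primitive intr_eq0 mulr0 sin0 mul0r.
have -> : c%:~R * (2 * pi) = (c * 2)%:~R * pi :> R by rewrite mulrA intrM.
by rewrite sin_int_pi mul0r; case: ifP => _; rewrite subr0 ?mulr1 ?mulr0.
Qed.

Lemma integral_sin_int (c : int) :
  (\int[mu]_(t in `[0%R, (2 * pi)%R]) (sin (c%:~R * t))%:E = 0%:E)%E.
Proof.
rewrite (integral_is_derive twopi_gt0 (@continuous_sinM R _)
  (@is_derive_sin_primitive R _)).
congr EFin; rewrite /sin_primitive; case: ifP; rewrite ?subr0//.
by rewrite cos_int_2pi mulr0 cos0 subrr.
Qed.

Lemma has_moment_dirac (x : R) eps :
  has_moment (dirac x%:C) eps (x ^+ size eps)%:C.
Proof.
have [mr mi] := @measurable_conj_word R eps.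
by rewrite -conj_word_real; split; exact: has_mean_dirac.
Qed.

(** On the circle of radius r a word of length m and charge d is r^m e^{idt}, whose
mean is 0 unless d = 0. *)
Lemma has_moment_uniform_circle (r : R) eps :
  has_moment (uniform_circle r) eps (r ^+ size eps * (word_charge eps == 0)%:R)%:C.
Proof.
have uni (f : R -> R) (s : R) : continuous f ->
    (\int[mu]_(t in `[0%R, (2 * pi)%R]) (f t)%:E = (2 * pi * s)%:E)%E ->
    has_mean (uniform_prob twopi_gt0) f s.
  move=> cf fs.
  have mw : measurable_fun [set: measurableTypeR R] (@uniform_pdf R 0 (2 * pi)).
    exact: measurable_uniform_pdf.
  pose w : {mfun measurableTypeR R >-> R} :=
    HB.pack (@uniform_pdf R 0 (2 * pi)) (isMeasurableFun.Build _ _ _ _ _ mw).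
  have w0 x : 0 <= w x by apply: uniform_pdf_ge0; exact: twopi_gt0.
  apply: (@eq_has_mean _ _ _ (density_measure mu w0)) => //.
  apply: has_mean_density; first exact: continuous_measurable_fun.
  have := has_meanZ (2 * pi)^-1 (has_mean_itv true false cf fs).
  rewrite mulKf ?gt_eqF ?twopi_gt0//.
  rewrite (_ : (fun _ => _) = (fun x => f x * w x))//.
  apply/funext => x; rewrite /w/= /uniform_pdf indicE mem_setE in_itv/= subr0.
  by case: ifP => _; rewrite ?mulr0// mulr1 mulrC.
have ReE t : complex.Re (conj_word (circle_map r t) eps) =
    r ^+ size eps * cos ((word_charge eps)%:~R * t).
  by rewrite /circle_map /polar/= conj_word_polar /= mul0r subr0.
have ImE t : complex.Im (conj_word (circle_map r t) eps) =
    r ^+ size eps * sin ((word_charge eps)%:~R * t).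
  by rewrite /circle_map /polar/= conj_word_polar /= mul0r addr0.
apply: has_moment_law.
- under eq_fun do rewrite ReE.
  apply: has_meanZ; apply: uni; [exact: continuous_cosM|exact: integral_cos_int].
- under eq_fun do rewrite ImE.
  rewrite -[complex.Im _](mulr0 (r ^+ size eps)).
  apply: has_meanZ; apply: uni; first exact: continuous_sinM.
  by rewrite mulr0; exact: integral_sin_int.
Qed.

(** On (-2, 2) the monomial x^m is dominated by 2^m, as [has_mean_arcsine] asks.
The upper limit b = pi gives the arcsine law and b = pi / 2 its radial half. *)
Lemma has_mean_arcsine_monomial (b : R) (m : nat) (c : R) : 0 < b -> b <= pi ->
  (\int[mu]_(x in `[0%R, b]) ((2 * cos x) ^+ m)%:E = c%:E)%E ->
  has_mean mu (fun x : R => x ^+ m *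
    (\1_(`]2 * cos b, 2[%classic) x * inv_semicircle x)) c.
Proof.
move=> b0 bpi hc.
have := @has_mean_arcsine R 0 b (@GRing.exp R ^~ m) c (2 ^+ m) (lexx _) b0 bpi.
rewrite cos0 mulr1; apply=> //; first exact: exprn_continuous.
by move=> x hx; rewrite normrX lerXn2r ?nnegrE// ler_norml; lra.
Qed.

Lemma has_moment_arcsine eps :
  has_moment (@arcsine R 2) eps (central_coef (size eps))%:R%:C.
Proof.
have ReE x : complex.Re (conj_word (@real_map R x) eps) = x ^+ size eps.
  by rewrite /real_map conj_word_real.
have ImE x : complex.Im (conj_word (@real_map R x) eps) = 0.
  by rewrite /real_map conj_word_real.
apply: has_moment_law.
- under eq_fun do rewrite ReE.
  apply: has_mean_density.
    apply: continuous_measurable_fun; exact: exprn_continuous.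
  have := has_meanZ pi^-1 (has_mean_arcsine_monomial (pi_gt0 R) (lexx _)
    (integral_pi_two_cosX (size eps))).
  rewrite mulKf ?gt_eqF ?pi_gt0// cospi mulrN1.
  rewrite (_ : (fun _ => _) = (fun x : R => x ^+ size eps * arcsine_pdf 2 x))//.
  apply/funext => x; rewrite /arcsine_pdf /inv_semicircle invfM; ring.
- under eq_fun do rewrite ImE.
  apply: has_mean_density => //.
  apply: has_mean_ge0 => [x| |]; rewrite ?mul0r//.
    by under eq_fun do rewrite mul0r; exact: measurable_cst.
  by under eq_integral do rewrite mul0r; rewrite integral0.
Qed.

(** The word and the density both split into a function of the radius times a
function of the angle. The angular factor vanishes for nonzero charge, so the
radial moment matters only in charge 0, where the length is even. *)
Lemma has_moment_complex_arcsine eps :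
  has_moment (@complex_arcsine R 2) eps
    ((word_charge eps == 0)%:R * (central_coef (size eps))%:R)%:C.
Proof.
set m := size eps; set c := word_charge eps.
have ReE p : complex.Re (conj_word (@polar R p) eps) = p.1 ^+ m * cos (c%:~R * p.2).
  by rewrite /polar conj_word_polar /= mul0r subr0.
have ImE p : complex.Im (conj_word (@polar R p) eps) = p.1 ^+ m * sin (c%:~R * p.2).
  by rewrite /polar conj_word_polar /= mul0r addr0.
have pihalf : 0 < pi / 2 :> R by rewrite divr_gt0// pi_gt0.
have pihalf_le : pi / 2 <= pi :> R by have := pi_gt0 R; lra.
pose w := (fun x : R => pi ^- 2 *
  (x ^+ m * (\1_(`]0, 2[%classic) x * inv_semicircle x))).
(* For odd m only the existence of the radial moment is used. *)
have [a radial a_even] : exists2 a, has_mean mu w a &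
    (~~ odd m -> a = (2 * pi)^-1 * (central_coef m)%:R).
  have I : mu.-integrable `[0%R, (pi / 2)%R] (EFin \o (fun x => (2 * cos x) ^+ m)).
    apply: continuous_compact_integrable; first exact: segment_compact.
    apply: continuous_subspaceT.
    exact: (continuous_comp_two_cos (@exprn_continuous R m)).
  have mI : measurable (`[0, pi / 2]%classic : set (measurableTypeR R)).
    exact: measurable_itv.
  have := integrable_fin_num mI I.
  move=> /fineK/esym/(has_mean_arcsine_monomial pihalf pihalf_le).
  rewrite cos_pihalf mulr0 => /(has_meanZ (pi ^- 2)) h; eexists; first exact: h.
  move=> /integral_pihalf_two_cosX ->; rewrite /= mulrA; congr (_ * _).
  have pi0 : pi != 0 :> R by rewrite gt_eqF// pi_gt0.
  by move: (@pi R) pi0 => p p0; field.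
have angular (f : R -> R) (b : R) : continuous f ->
    (\int[mu]_(t in `[0%R, (2 * pi)%R]) (f t)%:E = b%:E)%E -> measurable_fun setT f ->
    has_mean (density_measure (mu \x mu)%E (@polar_arcsine_pdf_ge0 R 2))
      (fun p => p.1 ^+ m * f p.2) (a * b).
  move=> cf fb mf.
  apply: has_mean_density.
    apply: measurable_funM.
      have mX : measurable_fun setT (fun x : R => x ^+ m).
        by apply: continuous_measurable_fun; exact: exprn_continuous.
      exact: (measurableT_comp mX measurable_fst).
    exact: (measurableT_comp mf measurable_snd).
  have := has_mean_prod radial (has_mean_itv false true cf fb).
  congr has_mean; apply/funext => -[x t]; rewrite /w /= /polar_arcsine_pdf /=.
  rewrite !indicE in_setX /= (invfM (pi ^+ 2)) /inv_semicircle.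
  by move: (@pi R) => p; case: (x \in _); case: (t \in _) => /=; ring.
apply: has_moment_law.
- under eq_fun do rewrite ReE.
  rewrite (_ : complex.Re _ = a * (2 * pi * (c == 0)%:R)).
    apply: (angular (fun t => cos (c%:~R * t))); [exact: continuous_cosM|exact: integral_cos_int|].
    by apply: continuous_measurable_fun; exact: continuous_cosM.
  have [c0|_] := eqVneq c 0; last by rewrite /= !mulr0 mul0r.
  rewrite a_even ?word_charge0_even//= mul1r mulr1 mulrAC mulVf ?mul1r//.
  by rewrite gt_eqF// twopi_gt0.
- under eq_fun do rewrite ImE.
  rewrite -[complex.Im _](mulr0 a).
  apply: (angular (fun t => sin (c%:~R * t))); [exact: continuous_sinM|exact: integral_sin_int|].
  by apply: continuous_measurable_fun; exact: continuous_sinM.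
Qed.

End moments.

(** * Roots of unity and shift matrices *)

Section mx2.
Context {A : pzRingType}.
Implicit Types a b c d : A.

(** This is the shape in which the representation [X_] is given. *)
Definition mx2 a b c d : 'M[A]_2 :=
  \matrix_(i < 2, j < 2)
    if i == 0 then (if j == 0 then a else b) else (if j == 0 then c else d).

Lemma mulmx2 a b c d a' b' c' d' :
  mx2 a b c d * mx2 a' b' c' d' =
  mx2 (a * a' + b * c') (a * b' + b * d') (c * a' + d * c') (c * b' + d * d').
Proof.
apply/matrixP => i j; rewrite !mxE !big_ord_recl big_ord0 !mxE /= addr0.
by case: ifP; case: ifP.
Qed.

Lemma mx2_diagX a d h : mx2 a 0 0 d ^+ h = mx2 (a ^+ h) 0 0 (d ^+ h).
Proof.
elim: h => [|h IH].
  apply/matrixP => i j; rewrite !mxE -val_eqE -!(inj_eq val_inj).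
  by case: i j => [[|[|[]]]] // ? [[|[|[]]]].
by rewrite exprS IH mulmx2 !(mul0r, mulr0, add0r, addr0) -!exprS.
Qed.

(** When diagonal and off-diagonal entries annihilate each other the square is
diagonal, and its powers are computed entrywise. *)
Lemma trace_mx2_even a b c d h : a * b = 0 -> b * d = 0 -> c * a = 0 -> d * c = 0 ->
  \tr (mx2 a b c d ^+ h.*2) = (a ^+ 2 + b * c) ^+ h + (d ^+ 2 + c * b) ^+ h.
Proof.
move=> ab bd ca dc; rewrite -mul2n exprM expr2 mulmx2 ab bd ca dc !addr0 mx2_diagX.
by rewrite /mxtrace !big_ord_recl big_ord0 !mxE /= addr0 -!expr2 (addrC (c * b)).
Qed.
End mx2.

Section roots_of_unity.
Context {R : realType}.
Variable n : nat.
Hypothesis n0 : (0 < n)%N.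

(** The power eta^z. Writing it with the angle z instead of an integer power makes
the passage to cosines immediate. *)
Definition zeta (z : int) : R[i] := expi (z%:~R * (2 * pi / n%:R)).

Lemma zetaD z w : zeta (z + w) = zeta z * zeta w.
Proof. by rewrite /zeta rmorphD /= mulrDl expiD. Qed.

Lemma zeta0 : zeta 0 = 1.
Proof. by rewrite /zeta mul0r expi0. Qed.

Lemma zetaX z k : zeta z ^+ k = zeta (z * k%:Z).
Proof. by rewrite /zeta expiX intrM mulrA mulrC; congr expi; ring. Qed.

Lemma zetaN z : zeta (- z) = (zeta z)^-1.
Proof.
have h : zeta z * zeta (- z) = 1 by rewrite -zetaD subrr zeta0.
have z0 : zeta z != 0 by apply: contra_eq_neq h => ->; rewrite mul0r eq_sym oner_eq0.
by rewrite -[LHS](mulKf z0) h mulr1.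
Qed.

Lemma eta_exprz z : Defs.eta n ^ z = zeta z.
Proof.
have etaX (k : nat) : Defs.eta n ^+ k = zeta k by rewrite /Defs.eta expiX.
by case: z => k; rewrite ?NegzE ?zetaN -?etaX.
Qed.

Lemma zeta_add_opp z : zeta z + zeta (- z) = (2 * cos (z%:~R * (2 * pi / n%:R)))%:C.
Proof. by rewrite /zeta rmorphN mulNr expi_add_conj. Qed.

Lemma zeta_dvd z : (n %| z)%Z -> zeta z = 1.
Proof.
move=> /dvdzP[q ->].
have nR : n%:R != 0 :> R by rewrite pnatr_eq0 -lt0n.
rewrite /zeta intrM -mulrA (mulrC n%:~R) divfK//.
rewrite /expi cos_int_2pi; have -> : q%:~R * (2 * pi) = (q * 2)%:~R * pi :> R.
  by rewrite mulrA intrM.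
by rewrite sin_int_pi.
Qed.

Lemma eq_zeta z w : (n %| z - w)%Z -> zeta z = zeta w.
Proof. by move=> h; rewrite -(subrK w z) zetaD zeta_dvd// mul1r. Qed.

(** If r is the remainder of z modulo n and r > 0, then Re (zeta z) =
1 - 2 sin^2 (pi r / n) < 1, since 0 < pi r / n < pi. *)
Lemma zeta_eq1 z : (zeta z == 1) = (n %| z)%Z.
Proof.
apply/eqP/idP; last exact: zeta_dvd.
move=> z1; apply/negPn/negP => nz.
have n0z : n%:Z != 0 by lia.
have : zeta (modz z n) = 1.
  by rewrite -z1; apply: eq_zeta; rewrite {2}(divz_eq z n) opprD addrCA subrr addr0 -mulNr dvdz_mull.
have mz : modz z n != 0 by apply: contraNneq nz => /dvdz_mod0P.
have : 0 < modz z n by rewrite lt_def mz modz_ge0.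
have := @ltz_pmod z n n0; move: (modz z n) => [r|//] rn r0.
rewrite /zeta => /(congr1 (@complex.Re R)) /= .
have nR : 0 < n%:R :> R by rewrite ltr0n.
have -> : r%:~R * (2 * pi / n%:R) = (r%:R * pi / n%:R) *+ 2 :> R.
  by rewrite -mulr_natl -pmulrn; ring.
rewrite cos_mulr2n cos2sin2 => h.
have : 0 < sin (r%:R * pi / n%:R : R).
  apply: sin_gt0_pi; apply/andP; split.
    by rewrite divr_gt0// mulr_gt0 ?pi_gt0// ltr0n.
  by rewrite ltr_pdivrMr// mulrC ltr_pM2l ?pi_gt0// ltr_nat.
move: h; set s := sin _ => h s0.
by move: h; rewrite mulr2n; nra.
Qed.

(** A geometric sum whose ratio is an n-th root of unity. *)
Lemma sum_zeta a : \sum_(i < n) zeta (i%:Z * a) = (n * (n %| a)%Z)%:R.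
Proof.
have E (i : 'I_n) : zeta (i%:Z * a) = zeta a ^+ i by rewrite zetaX mulrC.
under eq_bigr do rewrite E.
have [na|na] := boolP (n %| a)%Z.
  under eq_bigr do rewrite zeta_dvd// expr1n.
  by rewrite sumr_const card_ord muln1.
have h : (zeta a - 1) * (\sum_(i < n) zeta a ^+ i) = 0.
  by rewrite -subrX1 zetaX zeta_dvd ?subrr// dvdz_mull.
rewrite muln0; apply/eqP; move/eqP: h; rewrite mulf_eq0 subr_eq0 => /orP[|//].
by rewrite zeta_eq1 (negbTE na).
Qed.

(** The frequencies (m - 2l) a are smaller than n in absolute value, so n divides
none of them except 0: the average over roots of unity is then the exact constant
term. *)
Lemma sum_cosX a m : (`|a| * m < n)%N -> a != 0 ->
  \sum_(j < n) ((2 * cos ((j%:Z * a)%:~R * (2 * pi / n%:R))) ^+ m)%:C =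
  (n * central_coef m)%:R :> R[i].
Proof.
move=> amn a0.
have E (j : 'I_n) : ((2 * cos ((j%:Z * a)%:~R * (2 * pi / n%:R))) ^+ m)%:C =
    \sum_(l < m.+1) 'C(m, l)%:R * zeta (j%:Z * (a * (m%:Z - l.*2%:Z))).
  rewrite rmorphXn /= two_cosX; apply: eq_bigr => l _; congr (_ * expi _).
  by rewrite !(rmorphB, rmorphM)/= -!pmulrn; ring.
under eq_bigr do rewrite E.
rewrite exchange_big /= natrM /central_coef natr_sum mulr_sumr [RHS]big_mkcond/=.
apply: eq_bigr => l _; rewrite -mulr_sumr sum_zeta.
have [lm|lm] := eqVneq l.*2 m.
  by rewrite lm subrr mulr0 dvdz0 muln1 mulrC.
have lm1 : (l <= m)%N by rewrite -ltnS.
rewrite (_ : (n %| _)%Z = false) ?muln0 ?mulr0//; apply/negP.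
rewrite dvdzE abszM /= => /dvdn_leq.
have p1 : (0 < `|m - l.*2|)%N by lia.
have p2 : (`|m - l.*2| <= m)%N by lia.
rewrite muln_gt0 p1 absz_gt0 a0 => /(_ isT); rewrite leqNgt.
by rewrite (leq_ltn_trans _ amn)// leq_mul2l p2 orbT.
Qed.

Lemma ord_congr_inj (k l : 'I_n) : (n %| k%:Z - l%:Z)%Z -> k = l.
Proof.
move=> h; apply: val_inj => /=; have := ltn_ord k; have := ltn_ord l.
move: h; rewrite dvdzE => /dvdn_leq; have [->//|kl] := eqVneq (k : nat) l.
have : (0 < `|k - l|)%N by lia.
by move=> -> /(_ isT); lia.
Qed.

Lemma ord_congr_ex (z : int) : exists k : 'I_n, (n %| k%:Z - z)%Z.
Proof.
have n1 : n%:Z != 0 by lia.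
have := modz_ge0 z n1; have := @ltz_pmod z n n0.
case e : (modz z n) => [r|//] rn _; exists (Ordinal (rn : (r < n)%N)) => /=.
by rewrite -e {2}(divz_eq z n) opprD addrCA subrr addr0 -mulNr dvdz_mull.
Qed.

Lemma sum_ord_congr (F : 'I_n -> R[i]) (z : int) (k : 'I_n) : (n %| k%:Z - z)%Z ->
  \sum_(l < n) (if (n %| l%:Z - z)%Z then F l else 0) = F k.
Proof.
move=> kz; rewrite (bigD1 k)//= kz big1 ?addr0// => l lk.
case: ifP => // lz; move: lk; suff -> : l = k by rewrite eqxx.
apply: ord_congr_inj.
rewrite (_ : _ - _ = (l%:Z - z) - (k%:Z - z)); [exact: rpredB|ring].
Qed.

(** A power of eta in each row times a cyclic shift; this family contains the
off-diagonal entries of the representation and is closed under products. Indices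
are compared modulo n in the integers, so shifts by negative amounts need no
special treatment. *)
Definition twisted_shift (w a : int) : 'M[R[i]]_n :=
  \matrix_(i, j) if (n %| j%:Z - (i%:Z + a))%Z then zeta (i%:Z * w) else 0.

(** In row i of the left factor only the column k = i + a modulo n is nonzero, and
there the twist of the right factor is eta^{k w'} = eta^{i w'} eta^{a w'}. *)
Lemma mulmx_twisted_shift w w' a b :
  twisted_shift w a *m twisted_shift w' b =
  zeta (a * w') *: twisted_shift (w + w') (a + b).
Proof.
apply/matrixP => i j; rewrite !mxE.
have [k kz] := ord_congr_ex (i%:Z + a).
pose F (l : 'I_n) : R[i] := zeta (i%:Z * w) *
  (if (n %| j%:Z - (l%:Z + b))%Z then zeta (l%:Z * w') else 0).
rewrite (eq_bigr (fun l : 'I_n => if (n %| l%:Z - (i%:Z + a))%Z then F l else 0)).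
  rewrite (sum_ord_congr _ kz) /F.
  rewrite (_ : (n %| j%:Z - (k%:Z + b))%Z = (n %| j%:Z - (i%:Z + (a + b)))%Z).
    case: ifP => _; rewrite ?mulr0// (eq_zeta (z := k%:Z * w') (w := (i%:Z + a) * w')).
      by rewrite -!zetaD; congr zeta; ring.
    by rewrite -mulrBl dvdz_mulr.
  have -> : j%:Z - (i%:Z + (a + b)) = (j%:Z - (k%:Z + b)) + (k%:Z - (i%:Z + a)) by ring.
  by rewrite (rpredDr _ kz).
by move=> l _; rewrite !mxE; case: ifP => _; rewrite ?mul0r.
Qed.

Lemma trace_twisted_shift a :
  \sum_(i < n) twisted_shift 0 a i i = (n * (n %| a)%Z)%:R.
Proof.
rewrite (eq_bigr (fun=> ((n %| a)%Z)%:R)).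
  by rewrite sumr_const card_ord -mulrnA mulnC.
move=> i _; rewrite !mxE mulr0 zeta0 (_ : _ - _ = - a); last by ring.
by rewrite rpredN; case: ifP.
Qed.

Lemma twisted_shift00 : twisted_shift 0 0 = 1%:M.
Proof.
apply/matrixP => i j; rewrite !mxE mulr0 zeta0 addr0 eq_sym.
have [->|ij] := eqVneq j i; first by rewrite subrr dvdz0.
by case: ifP => // /ord_congr_inj ji; rewrite ji eqxx in ij.
Qed.

Lemma twisted_shiftX a h : (twisted_shift 0 a : 'M[R[i]]_n) ^+ h = twisted_shift 0 (a * h%:Z).
Proof.
elim: h => [|h IH]; first by rewrite mulr0 twisted_shift00.
rewrite exprS IH -[LHS]/(_ *m _) mulmx_twisted_shift mulr0 zeta0 scale1r addr0.
by congr twisted_shift; rewrite -addn1 PoszD; ring.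
Qed.

Lemma adj_twisted_shift a :
  map_mx Num.conj (twisted_shift 0 a)^T = twisted_shift 0 (- a).
Proof.
apply/matrixP => i j; rewrite !mxE !mulr0 zeta0 (fun_if Num.conj) rmorph1 rmorph0.
by rewrite -rpredN; have -> : - (i%:Z - (j%:Z + a)) = j%:Z - (i%:Z - a) by ring.
Qed.

End roots_of_unity.

(** * Words in the character of an even power *)

Section sekine_words.
Context {R : realType}.
Variable n : nat.
Hypothesis n0 : (0 < n)%N.
Notation A := (@sekine R n).
Implicit Types (x y : A) (p : 'I_n * 'I_n) (u v h : nat).

Lemma sum_fun_part (I : Type) (r : seq I) (F : I -> A) p :
  (\sum_(i <- r) F i).1 p = \sum_(i <- r) (F i).1 p.
Proof.
by apply: (big_morph (fun x : A => x.1 p)) => [x y|]; rewrite ffunE.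
Qed.

Lemma sum_mx_part (I : Type) (r : seq I) (F : I -> A) :
  (\sum_(i <- r) F i).2 = \sum_(i <- r) (F i).2.
Proof. by apply: (big_morph (fun x : A => x.2)). Qed.

Lemma exp_fun_part x k p : (x ^+ k).1 p = x.1 p ^+ k.
Proof.
elim: k => [|k IH]; first by rewrite !expr0 ffunE.
by rewrite !exprS -IH ffunE.
Qed.

Lemma exp_mx_part x k : (x ^+ k).2 = x.2 ^+ k.
Proof. by elim: k => [//|k IH]; rewrite !exprS -IH. Qed.

Lemma mul_fun_part x y p : (x * y).1 p = x.1 p * y.1 p.
Proof. by rewrite ffunE. Qed.

Lemma add_fun_part x y p : (x + y).1 p = x.1 p + y.1 p.
Proof. by rewrite ffunE. Qed.

Lemma mul_mx_part x y : (x * y).2 = x.2 *m y.2.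
Proof. by []. Qed.

Lemma add_mx_part x y : (x + y).2 = x.2 + y.2.
Proof. by []. Qed.

Lemma X11_mx u v : (X11 n u v : A).2 = 0.
Proof.
rewrite /X11 sum_mx_part big1// => i _; rewrite sum_mx_part big1// => j _.
by rewrite /= scaler0.
Qed.

Lemma X22_mx u v : (X22 n u v : A).2 = 0.
Proof.
rewrite /X22 sum_mx_part big1// => i _; rewrite sum_mx_part big1// => j _.
by rewrite /= scaler0.
Qed.

Lemma double_sum_delta (c : 'I_n -> 'I_n -> R[i]) p :
  (\sum_(i < n) \sum_(j < n) c i j *: (e_ i j : A)).1 p = c p.1 p.2.
Proof.
rewrite sum_fun_part (bigD1 p.1)//= sum_fun_part (bigD1 p.2)//= !ffunE.
rewrite -surjective_pairing eqxx.
rewrite [X in _ + X]big1 => [|i ip]; last first.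
  rewrite sum_fun_part big1// => j _; rewrite !ffunE.
  have -> : (p == (i, j)) = false by apply: contraNF ip => /eqP ->.
  by rewrite scaler0.
rewrite big1 => [|j jp]; last first.
  rewrite !ffunE.
  have -> : (p == (p.1, j)) = false by apply: contraNF jp => /eqP ->.
  by rewrite scaler0.
by rewrite !addr0 -[RHS]mulr1.
Qed.

Lemma X11_fun u v p :
  (X11 n u v : A).1 p = zeta n ((p.1 * u)%:Z + (p.2 * v)%:Z).
Proof. by rewrite /X11 double_sum_delta eta_exprz. Qed.

Lemma X22_fun u v p :
  (X22 n u v : A).1 p = zeta n ((p.1 * u)%:Z - (p.2 * v)%:Z).
Proof. by rewrite /X22 double_sum_delta eta_exprz. Qed.

Lemma ord_shift_congr (i j : 'I_n) u : (j == ord_shift i u) = (n %| j%:Z - (i%:Z + u%:Z))%Z.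
Proof.
have hs : (n %| (ord_shift i u : nat)%:Z - (i%:Z + u%:Z))%Z.
  rewrite -PoszD -modz_nat {2}(divz_eq (i + u)%N n) opprD addrCA subrr addr0 -mulNr.
  exact: dvdz_mull.
apply/eqP/idP => [->//|hj]; apply: ord_congr_inj => //.
have -> : j%:Z - (ord_shift i u : nat)%:Z =
  (j%:Z - (i%:Z + u%:Z)) - ((ord_shift i u : nat)%:Z - (i%:Z + u%:Z)) by ring.
exact: rpredB.
Qed.

Lemma sum_shift_units (c : 'I_n -> R[i]) u (w : int) :
  (forall i : 'I_n, c i = zeta n (i%:Z * w)) ->
  \sum_(i < n) c i *: (E_ i (ord_shift i u) : A) = (0, twisted_shift n w u).
Proof.
move=> cE; apply: injective_projections.
  apply/ffunP => p; rewrite sum_fun_part big1 ?ffunE// => i _.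
  by rewrite !ffunE scaler0.
rewrite sum_mx_part /=; apply/matrixP => a b; rewrite summxE (bigD1 a)//= big1.
  rewrite addr0 !mxE eqxx ord_shift_congr cE.
  by case: ifP; rewrite ?mulr1 ?mulr0.
by move=> i /negbTE ia; rewrite !mxE eq_sym ia mulr0.
Qed.

Lemma X12E u v : (X12 n u v : A) = (0, twisted_shift n (- v%:Z) u).
Proof. by apply: sum_shift_units => i; rewrite eta_exprz// PoszM mulrN. Qed.

Lemma X21E u v : (X21 n u v : A) = (0, twisted_shift n v u).
Proof. by apply: sum_shift_units => i; rewrite eta_exprz// PoszM. Qed.

Notation theta := (2 * pi / n%:R : R).

(** [trace_mx2_even] applies because the diagonal entries have no matrix part and
the off-diagonal entries no function part. *)
Lemma chi_even u v h : chi (X_ n u v ^+ h.*2) =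
  (X11 n u v ^+ 2 + X12 n u v * X21 n u v) ^+ h +
  (X22 n u v ^+ 2 + X21 n u v * X12 n u v) ^+ h :> A.
Proof.
have ortho x y : x.2 = 0 -> y.1 = 0 -> x * y = 0 /\ y * x = 0.
  case: x y => [f f'] [g g'] /= -> ->.
  by split; apply: injective_projections; rewrite /= ?mulr0 ?mul0r.
have b1 : (X12 n u v : A).1 = 0 by rewrite X12E.
have c1 : (X21 n u v : A).1 = 0 by rewrite X21E.
have [ab _] := ortho _ _ (X11_mx u v) b1.
have [_ ca] := ortho _ _ (X11_mx u v) c1.
have [_ bd] := ortho _ _ (X22_mx u v) b1.
have [dc _] := ortho _ _ (X22_mx u v) c1.
exact: (trace_mx2_even h ab bd ca dc).
Qed.

Lemma even_power_fun x y z w h p : y.1 = 0 -> z.1 = 0 ->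
  ((x ^+ 2 + y * z) ^+ h + (w ^+ 2 + z * y) ^+ h).1 p =
  x.1 p ^+ h.*2 + w.1 p ^+ h.*2.
Proof.
move=> y0 z0; rewrite add_fun_part !exp_fun_part !add_fun_part !exp_fun_part.
by rewrite !mul_fun_part y0 z0 !ffunE !mulr0 !addr0 -!exprM mul2n.
Qed.

Lemma even_power_mx x y z w h : x.2 = 0 -> w.2 = 0 ->
  ((x ^+ 2 + y * z) ^+ h + (w ^+ 2 + z * y) ^+ h).2 =
  (y.2 *m z.2 : 'M[R[i]]_n) ^+ h + (z.2 *m y.2 : 'M[R[i]]_n) ^+ h.
Proof.
move=> x0 w0; rewrite add_mx_part !exp_mx_part !add_mx_part !exp_mx_part x0 w0.
by rewrite expr0n !add0r !mul_mx_part.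
Qed.

Lemma X12_fun u v : (X12 n u v : A).1 = 0.
Proof. by rewrite X12E. Qed.

Lemma X21_fun u v : (X21 n u v : A).1 = 0.
Proof. by rewrite X21E. Qed.

(** At (i, j) the two diagonal entries are eta^{iu + jv} and eta^{iu - jv}; their
k-th powers share the phase eta^{kiu} and add up to twice a cosine. *)
Lemma chi_even_fun u v h p : (chi (X_ n u v ^+ h.*2) : A).1 p =
  (2 * cos ((p.2%:Z * (h.*2 * v)%:Z)%:~R * theta))%:C *
  zeta n (p.1%:Z * (h.*2 * u)%:Z).
Proof.
rewrite chi_even (even_power_fun _ _ _ _ (X12_fun u v) (X21_fun u v)).
rewrite X11_fun X22_fun !zetaX -zeta_add_opp [RHS]mulrDl -!zetaD.
by congr (zeta _ _ + zeta _ _); rewrite !PoszM; ring.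
Qed.

Lemma expmxZ (c : R[i]) (B : 'M[R[i]]_n) h : (c *: B) ^+ h = c ^+ h *: B ^+ h.
Proof.
elim: h => [|h IH]; first by rewrite !expr0 scale1r.
by rewrite !exprS IH -[LHS]/(_ *m _) -scalemxAl -scalemxAr scalerA.
Qed.

(** X12 X21 and X21 X12 are the same shift by 2u, with the opposite phases eta^{uv}
and eta^{-uv}; their h-th powers add up to twice a cosine. *)
Lemma chi_even_mx u v h : (chi (X_ n u v ^+ h.*2) : A).2 =
  (2 * cos ((u * v * h)%:Z%:~R * theta))%:C *: twisted_shift n 0 (h.*2 * u)%:Z.
Proof.
rewrite chi_even (even_power_mx _ _ _ (X11_mx u v) (X22_mx u v)) X12E X21E /=.
rewrite !mulmx_twisted_shift// addNr subrr !expmxZ !twisted_shiftX// -scalerDl.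
congr (_ *: twisted_shift _ _ _).
  by rewrite !zetaX mulrN mulNr -zeta_add_opp !PoszM.
by rewrite -mul2n !PoszM; ring.
Qed.

Lemma star_word_fun x eps p : (star_word x eps).1 p = conj_word (x.1 p) eps.
Proof.
elim: eps => [|b eps IH]; first by rewrite /star_word /conj_word !big_nil ffunE.
rewrite conj_word_cons -IH /star_word big_cons mul_fun_part.
by case: b; rewrite //= ffunE.
Qed.

(** The adjoint of a shift is the opposite shift, so a word in a real multiple of a
shift is again a multiple of a shift, by the charge of the word. *)
Lemma star_word_shift x (c : R) a eps : x.2 = c%:C *: twisted_shift n 0 a ->
  (star_word x eps).2 =
  (c ^+ size eps)%:C *: twisted_shift n 0 (word_charge eps * a).
Proof.
move=> xE; elim: eps => [|b eps IH].
  by rewrite /star_word /word_charge !big_nil mul0r scale1r twisted_shift00.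
rewrite /star_word big_cons mul_mx_part -/(star_word x eps) {}IH word_charge_cons.
rewrite (_ : (if b then star x else x).2 =
    c%:C *: twisted_shift n 0 ((if b then -1 else 1) * a)); last first.
  case: b; last by rewrite mul1r.
  rewrite /= xE linearZ /= map_mxZ /= adj_twisted_shift mulN1r; congr (_ *: _).
  exact: conjc_real.
rewrite -scalemxAl -scalemxAr mulmx_twisted_shift// scalerA mulr0 zeta0 scale1r addr0.
by rewrite mulrDl exprS (rmorphM (real_complex R)).
Qed.

(** Both summands of the algebra contribute the same indicator, that n divides
k u d, which for n large means that u d = 0. *)
Lemma haar_star_word u v h eps :
  (0 < v)%N -> (0 < h)%N -> (h.*2 * v * size eps < n)%N ->
  (h.*2 * u * `|word_charge eps| < n)%N ->
  haar (star_word (chi (X_ n u v ^+ h.*2) : A) eps) =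
  ((word_charge eps * u == 0)%:R / 2 *
   ((central_coef (size eps))%:R +
    (2 * cos ((u * v * h)%:R * theta)) ^+ size eps))%:C.
Proof.
move=> v0 h0 hm hd; set m := size eps; set d := word_charge eps.
set a : int := d * (h.*2 * u)%:Z.
(* As n exceeds the absolute value of a, it divides a only if a = 0. *)
have a_dvd : (n %| a)%Z = (d * u == 0).
  apply/idP/eqP => [|du0]; last first.
    rewrite (_ : a = 0) ?dvdz0//.
    by rewrite /a PoszM mulrCA du0 mulr0.
  rewrite dvdzE /a => h1; have [//|du] := eqVneq (d * u%:Z) 0.
  have : (0 < absz (d * (h.*2 * u)%:Z)%R)%N.
    by rewrite absz_gt0 PoszM mulrCA mulf_neq0//; lia.
  move=> /(dvdn_leq) /(_ h1); rewrite abszM /= leqNgt mulnC.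
  by move=> /negP; rewrite hd.
have nC : n%:R != 0 :> R[i] by rewrite pnatr_eq0 -lt0n.
have fun_part : \sum_(i < n) \sum_(j < n) (star_word (chi (X_ n u v ^+ h.*2) : A) eps).1 (i, j) =
   (n * (n %| a)%Z)%:R * (n * central_coef m)%:R.
  rewrite -(@sum_zeta R n n0 a) mulr_suml; apply: eq_bigr => i _.
  have a0 : (h.*2 * v)%:Z != 0 by lia.
  rewrite -(@sum_cosX R n n0 _ m _ a0)// mulr_sumr; apply: eq_bigr => j _.
  rewrite star_word_fun chi_even_fun conj_word_polar /= mulrC; congr (_ * _).
  by rewrite /zeta /a mulrA -intrM; congr (expi (_%:~R * _)); ring.
have mx_part : \sum_(i < n) (star_word (chi (X_ n u v ^+ h.*2) : A) eps).2 i i =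
   ((2 * cos ((u * v * h)%:R * theta)) ^+ m)%:C * (n * (n %| a)%Z)%:R.
  rewrite (star_word_shift _ (chi_even_mx u v h)) -(@trace_twisted_shift R n a) mulr_sumr.
  by apply: eq_bigr => i _; rewrite mxE.
rewrite /haar fun_part mx_part a_dvd !natrM.
rewrite [RHS]rmorphM rmorphD /= fmorph_div /= !rmorph_nat.
set C := ((_ ^+ m)%:C); set K := _%:R; set D := (_ == 0)%:R.
by field; exact: nC.
Qed.

End sekine_words.

(** * Passage to the limit *)

Section limits.
Context {R : realType}.

Lemma cvg_real_complex (f : nat -> R) (l : R) :
  f @ \oo --> l -> (fun n => (f n)%:C : R[i]^o) @ \oo --> (l%:C : R[i]^o).
Proof.
move=> fl; apply/cvgrPdist_lt => -[e e'] /=.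
rewrite ltcE /= => /andP[/eqP -> e0].
near=> n.
rewrite -rmorphB normc_def /= expr0n /= addr0 sqrtr_sqr ltcR.
by near: n; exact: cvgr_dist_lt.
Unshelve. all: by end_near. Qed.

Lemma cvg_two_cosX (c : R) (m : nat) :
  (fun n => (2 * cos (c * (2 * pi / n%:R))) ^+ m) @ \oo --> (2 ^+ m : R).
Proof.
have h0 : (fun n => c * (2 * pi / n%:R)) @ \oo --> (0 : R).
  rewrite -[X in _ --> X](mulr0 c) -[X in _ --> c * X](mulr0 (2 * pi)).
  apply: cvgMr; apply: cvgMr.
  rewrite -(cvg_shiftS (fun n => (n%:R : R)^-1)).
  exact: cvg_harmonic.
have h1 : (fun n => 2 * cos (c * (2 * pi / n%:R))) @ \oo --> (2 * cos 0 : R).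
  apply: cvgMr.
  by apply: (continuous_cvg _ _ h0); exact: continuous_cos.
rewrite cos0 mulr1 in h1.
apply: (@cvg_comp _ _ _ (fun n : nat => 2 * cos (c * (2 * pi / n%:R)))
  (fun x : R => x ^+ m) _ _ _ h1).
exact: exprn_continuous.
Qed.

Lemma cvg_haar_star_word u v h eps : (0 < v)%N -> (0 < h)%N ->
  (fun n => haar (star_word (chi (X_ n u v ^+ h.*2) : @sekine R n) eps) : R[i]^o)
    @ \oo -->
  ((((word_charge eps * u == 0)%:R * 2 ^+ size eps +
     (word_charge eps * u == 0)%:R * (central_coef (size eps))%:R) / 2)%:C : R[i]^o).
Proof.
move=> v0 h0; set s := (_ == 0)%:R; set m := size eps.
pose f n : R := s / 2 * ((central_coef m)%:R +
  (2 * cos ((u * v * h)%:R * (2 * pi / n%:R))) ^+ m).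
have fl : f @ \oo --> ((s * 2 ^+ m + s * (central_coef m)%:R) / 2 : R).
  rewrite (_ : (_ + _) / 2 = s / 2 * ((central_coef m)%:R + 2 ^+ m)); last by field.
  by apply: cvgMr; apply: cvgD; [exact: cvg_cst|exact: cvg_two_cosX].
apply: cvg_trans (cvg_real_complex fl).
apply: near_eq_cvg; near=> n.
have n1 : (h.*2 * v * m < n)%N by near: n; exact: nbhs_infty_gt.
have n2 : (h.*2 * u * `|word_charge eps| < n)%N by near: n; exact: nbhs_infty_gt.
have n0 : (0 < n)%N by exact: leq_ltn_trans n1.
by rewrite haar_star_word.
Unshelve. all: by end_near. Qed.

End limits.

Theorem theorem3p5 (R : realType) (u v k : nat) (u_ge1 : (1 <= u)%N)
    (v_ge1 : (1 <= v)%N) (k_ge2 : (2 <= k)%N) (k_even : ~~ odd k) :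
  asymptotic_star_distribution
    (fun n => chi (X_ n u v ^+ k) : @sekine R n)
    (half_mixture (uniform_circle 2) (complex_arcsine 2)) /\
  asymptotic_star_distribution
    (fun n => chi (X_ n 0 v ^+ k) : @sekine R n)
    (half_mixture (dirac 2%:C) (arcsine 2)).
Proof.
have [h kE] : exists h, k = h.*2 by exists k./2; rewrite even_halfK.
have h0 : (0 < h)%N by move: k_ge2; rewrite kE; case: h {kE}.
have c0 : central_coef 0 = 1%N by rewrite /central_coef big_mkcond big_ord_recl big_ord0.
rewrite {}kE {k k_ge2 k_even}; split.
- apply: (@asymptotic_star_distributionP _ _ _ (fun eps =>
    (((word_charge eps == 0)%:R * 2 ^+ size eps +
      (word_charge eps == 0)%:R * (central_coef (size eps))%:R) / 2)%:C)).
  + move=> eps; apply: has_moment_half_mixture.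
      by rewrite mulrC; exact: has_moment_uniform_circle.
    exact: has_moment_complex_arcsine.
  + by rewrite /word_charge big_nil eqxx !mul1r c0 divff.
  + move=> eps; have := @cvg_haar_star_word R u v h eps v_ge1 h0.
    by rewrite mulf_eq0 (_ : (u%:Z == 0) = false) ?orbF//; lia.
- apply: (@asymptotic_star_distributionP _ _ _ (fun eps =>
    ((2 ^+ size eps + (central_coef (size eps))%:R) / 2)%:C)).
  + move=> eps; apply: has_moment_half_mixture.
      exact: has_moment_dirac.
    by have := @has_moment_arcsine R eps.
  + by rewrite c0 divff.
  + move=> eps; have := @cvg_haar_star_word R 0 v h eps v_ge1 h0.
    by rewrite mulr0 eqxx !mul1r.
Qed.
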